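(* Let $(\mathcal{B}_+,\mathcal{B}_0,\mathcal{B}_-)$ be a quasi Gelfand triple with duality map $\Psi:\mathcal{B}_-\to\mathcal{B}_+$, let $A_0$ be a densely defined, closed, skew-symmetric operator on a Hilbert space $X$, and let $B_1:\operatorname{dom}A_0^*\to\mathcal{B}_+$, $B_2:\operatorname{dom}A_0^*\to\mathcal{B}_-$ be linear maps such that $(\mathcal{B}_+,B_1,\Psi B_2)$ is a boundary triple for $A_0^*$. Let $\mathcal{K}$ be a Hilbert space and $V_1,V_2:\mathcal{B}_0\to\mathcal{K}$ bounded linear operators. Define $$D:=\Big\{a\in\operatorname{dom}A_0^*: B_1a,\,B_2a\in\mathcal{B}_0\ \text{ and }\ V_1B_1a+V_2B_2a=0\Big\}$$ and $A:=A_0^*\big|_D$. If (i) $\begin{bmatrix}V_1|_{\mathcal{B}_0\cap\mathcal{B}_+}&V_2|_{\mathcal{B}_0\cap\mathcal{B}_-}\end{bmatrix}$, $(f,g)\mapsto V_1f+V_2g$, with domain $(\mathcal{B}_0\cap\mathcal{B}_+)\times(\mathcal{B}_0\cap\mathcal{B}_-)$, is closed as an operator from $\mathcal{B}_+\times\mathcal{B}_-$ to $\mathcal{K}$, (ii) $\ker\begin{bmatrix}V_1&V_2\end{bmatrix}=\{(f,g)\in\mathcal{B}_0\times\mathcal{B}_0:V_1f+V_2g=0\}$ is dissipative as a linear relation on $\mathcal{B}_0$, (iii) $V_1V_2^*+V_2V_1^*\ge0$ as an operator on $\mathcal{K}$, then $A$ is a generator of a contraction semigroup on $X$.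
   Context: Inner products are linear in the first and antilinear in the second argument. **Quasi Gelfand triple.** Let $\mathcal{B}_0$ be a Hilbert space, $\tilde D_+\subseteq\mathcal{B}_0$ a dense linear subspace, and $\langle\cdot,\cdot\rangle_{\mathcal{B}_+}$ another inner product on $\tilde D_+$, not necessarily related to that of $\mathcal{B}_0$; $\mathcal{B}_+$ is the completion of $\tilde D_+$ with respect to $\|\cdot\|_{\mathcal{B}_+}$. Put $\|g\|_{\mathcal{B}_-}:=\sup_{f\in\tilde D_+\setminus\{0\}}|\langle g,f\rangle_{\mathcal{B}_0}|/\|f\|_{\mathcal{B}_+}$ for $g\in\mathcal{B}_0$, $D_-:=\{g\in\mathcal{B}_0:\|g\|_{\mathcal{B}_-}<\infty\}$, and let $\mathcal{B}_-$ be the completion of $D_-$ with respect to $\|\cdot\|_{\mathcal{B}_-}$. It is assumed that the embedding $\iota_+:\tilde D_+\subseteq\mathcal{B}_+\to\mathcal{B}_0$, $f\mapsto f$, is closable with injective closure. $D_+$ is the domain of this closure (the closure of $\tilde D_+$ with respect to $(\|\cdot\|_{\mathcal{B}_+}^2+\|\cdot\|_{\mathcal{B}_0}^2)^{1/2}$), regarded as a subspace of both $\mathcal{B}_+$ and $\mathcal{B}_0$; the closure is again denoted $\iota_+$. One writes $\mathcal{B}_0\cap\mathcal{B}_+=D_+$ and $\mathcal{B}_0\cap\mathcal{B}_-=D_-$; ''$B_1a\in\mathcal{B}_0$'' means $B_1a\in D_+$ and ''$B_2a\in\mathcal{B}_0$'' means $B_2a\in D_-$. The adjoint $\iota_+^*:\mathcal{B}_0\to\mathcal{B}_+$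 has domain $D_-$, is isometric from $(D_-,\|\cdot\|_{\mathcal{B}_-})$ to $\mathcal{B}_+$, and extends uniquely to a bijective linear isometry $\Psi:\mathcal{B}_-\to\mathcal{B}_+$, the duality map. With the pairing $\langle g,f\rangle_{\mathcal{B}_-,\mathcal{B}_+}:=\langle\Psi g,f\rangle_{\mathcal{B}_+}$, $(\mathcal{B}_+,\mathcal{B}_0,\mathcal{B}_-)$ is called a quasi Gelfand triple; the pairing equals $\langle g,f\rangle_{\mathcal{B}_0}$ for $g\in D_-$, $f\in D_+$. **Boundary triple.** For a densely defined, skew-symmetric ($A_0\subseteq-A_0^*$), closed operator $A_0$ on $X$, a boundary triple for $A_0^*$ is $(\mathcal{B},C_1,C_2)$ with $\mathcal{B}$ a Hilbert space and linear $C_1,C_2:\operatorname{dom}A_0^*\to\mathcal{B}$ such that $x\mapsto(C_1x,C_2x)$ is surjective onto $\mathcal{B}\times\mathcal{B}$ and $\langle A_0^*x,y\rangle_X+\langle x,A_0^*y\rangle_X=\langle C_1x,C_2y\rangle_{\mathcal{B}}+\langle C_2x,C_1y\rangle_{\mathcal{B}}$ for all $x,y\in\operatorname{dom}A_0^*$. A linear relation $T\subseteq H\times H$ on a Hilbert space $H$ is dissipative if $\operatorname{Re}\langle x,y\rangle_H\le0$ for all $(x,y)\in T$. A contraction semigroup is a strongly continuous semigroup of contractions. *)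

(* Defs.v *)
From HB Require Import structures.
From mathcomp Require Import all_boot all_order all_algebra.
From mathcomp Require Import complex.
From mathcomp Require Import all_classical all_reals all_analysis.

Set Implicit Arguments.
Unset Strict Implicit.
Unset Printing Implicit Defensive.

Import Order.TTheory GRing.Theory Num.Theory.
Import numFieldNormedType.Exports.

Local Open Scope classical_set_scope.
Local Open Scope ring_scope.
Local Open Scope complex_scope.

HB.mixin Record CompleteNormedModule_isHilbert (R : realType) H
    of CompleteNormedModule R[i] H := {
  inner : {dot H for (@Num.conj R[i])} ;
  inner_norm : forall x : H, inner x x = `|x| ^+ 2
}.

#[short(type="hilbertType")]
HB.structure Definition Hilbert (R : realType) :=
  {H of CompleteNormedModule_isHilbert R H & CompleteNormedModule R[i] H}.

Notation "''[' u , v ]" := (inner u v) : ring_scope.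

(* A norm takes values in the scalar field [R[i]]; this is the real number. *)
Definition rnorm (R : realType) (V : normedModType R[i]) (x : V) : R :=
  complex.Re `|x|.

Section LinearRelations.
Context {K : numFieldType}.

Definition subspace (U : lmodType K) (D : set U) : Prop :=
  D 0 /\ forall (a : K) (x y : U), D x -> D y -> D (a *: x + y).

(* Only the values of [f] on [D] matter: a linear map with domain [D] is a
   total function constrained on [D] only. *)
Definition linear_on (U V : lmodType K) (D : set U) (f : U -> V) : Prop :=
  forall (a : K) (x y : U), D x -> D y -> f (a *: x + y) = a *: f x + f y.

(* Unbounded operators are identified with their graphs, which are linear
   relations; closedness and closure are those of the graph in the product
   topology. *)
Definition dom (U V : Type) (S : set (U * V)) : set U :=
  [set x | exists y, S (x, y)].

Definition functional (U V : Type) (S : set (U * V)) : Prop :=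
  forall x y y', S (x, y) -> S (x, y') -> y = y'.

Definition injective_rel (U V : Type) (S : set (U * V)) : Prop :=
  forall x x' y, S (x, y) -> S (x', y) -> x = x'.

Definition restriction (U V : Type) (S : set (U * V)) (D : set U) :
    set (U * V) :=
  [set p | S p /\ D p.1].

Definition graph (U V : Type) (f : U -> V) : set (U * V) :=
  [set p | p.2 = f p.1].

Definition linear_operator (U V : lmodType K) (S : set (U * V)%type) : Prop :=
  subspace S /\ functional S.

End LinearRelations.

Section HilbertOperators.
Context {R : realType}.

Definition adjoint (H1 H2 : hilbertType R) (S : set (H1 * H2)) :
    set (H2 * H1) :=
  [set q | forall p, S p -> '[p.2, q.1] = '[p.1, q.2]].

Definition skew_symmetric (H : hilbertType R) (S : set (H * H)) : Prop :=
  forall p, S p -> adjoint S (p.1, - p.2).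

Definition dissipative (H : hilbertType R) (S : set (H * H)) : Prop :=
  forall p, S p -> complex.Re '[p.1, p.2] <= 0.

Definition bounded_operator (U V : normedModType R[i]) (f : U -> V) : Prop :=
  exists M : R, forall x, rnorm (f x) <= M * rnorm x.

(* The adjoint of a bounded everywhere defined operator, as a function; the
   vector picked exists and is unique by the Riesz representation theorem. *)
Definition bounded_adjoint (H1 H2 : hilbertType R) (f : H1 -> H2) (k : H2) :
    H1 :=
  xget 0 [set h | adjoint (graph f) (k, h)].

(* In the order of [R[i]], [0 <= z] entails that [z] is real. *)
Definition nonneg_operator (H : hilbertType R) (P : H -> H) : Prop :=
  forall k, 0 <= '[P k, k].

Definition contraction_semigroup (X : hilbertType R)
    (T : R -> {linear X -> X}) : Prop :=
  [/\ forall x, T 0 x = x,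
      forall (s t : R) x, 0 <= s -> 0 <= t -> T (s + t) x = T s (T t x),
      forall x, {within `[0, +oo[, continuous (fun t : R => T t x)} &
      forall (t : R) x, 0 <= t -> rnorm (T t x) <= rnorm x].

Definition infinitesimal_generator (X : hilbertType R)
    (T : R -> {linear X -> X}) : set (X * X) :=
  [set p | (h^-1)%:C *: (T h p.1 - p.1) @[h --> 0^'+] --> p.2].

Definition generates_contraction_semigroup (X : hilbertType R)
    (A : set (X * X)) : Prop :=
  exists T : R -> {linear X -> X},
    contraction_semigroup T /\ A = infinitesimal_generator T.

Definition boundary_triple (X B : hilbertType R) (A0 : set (X * X))
    (C1 C2 : X -> B) : Prop :=
  [/\ linear_on (dom (adjoint A0)) C1,
      linear_on (dom (adjoint A0)) C2,
      forall b1 b2, exists2 x, dom (adjoint A0) x & C1 x = b1 /\ C2 x = b2 &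
      forall p q, adjoint A0 p -> adjoint A0 q ->
        '[p.2, q.1] + '[p.1, q.2] = '[C1 p.1, C2 q.1] + '[C2 p.1, C1 q.1]].

End HilbertOperators.

Section QuasiGelfand.
Context {R : realType}.

Definition inner_product_on (U : lmodType R[i]) (D : set U)
    (ip : U -> U -> R[i]) : Prop :=
  [/\ forall (a : R[i]) x y z, D x -> D y -> D z ->
        ip (a *: x + y) z = a * ip x z + ip y z,
      forall x y, D x -> D y -> ip y x = Num.conj (ip x y) &
      forall x, D x -> x != 0 -> 0 < ip x x].

Definition ip_norm (U : Type) (ip : U -> U -> R[i]) (x : U) : R :=
  Num.sqrt (complex.Re (ip x x)).

(* [W] (complete by its type) together with the embedding [j] is a completion
   of the space [D] normed by [N]. *)
Definition completion (U : lmodType R[i]) (D : set U) (N : U -> R)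
    (W : completeNormedModType R[i]) (j : U -> W) : Prop :=
  [/\ linear_on D j, forall x, D x -> rnorm (j x) = N x & dense (j @` D)].

(* The supremum defining the dual norm; it is [-oo] (hence 0 after [fine])
   when [D] is trivial. *)
Definition dual_norm (H : hilbertType R) (D : set H) (N : H -> R) (g : H) :
    \bar R :=
  ereal_sup [set (complex.Re `|'[g, f]| / N f)%:E | f in D `\ 0].

Definition dual_dom (H : hilbertType R) (D : set H) (N : H -> R) : set H :=
  [set g | (dual_norm D N g < +oo)%E].

Record quasi_gelfand_triple (Bp B0 : hilbertType R)
    (Bm : completeNormedModType R[i]) := QuasiGelfandTriple {
  (* [qg_dom] is the dense subspace whose completion for [qg_ip] is B+ *)
  qg_dom : set B0 ;
  qg_ip : B0 -> B0 -> R[i] ;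
  qg_emb_p : B0 -> Bp ;
  qg_emb_m : B0 -> Bm ;
  qg_subspace : subspace qg_dom ;
  qg_dense : dense qg_dom ;
  qg_inner : inner_product_on qg_dom qg_ip ;
  qg_completion_p : completion qg_dom (ip_norm qg_ip) qg_emb_p ;
  qg_completion_m :
    completion (dual_dom qg_dom (ip_norm qg_ip))
      (fun g => fine (dual_norm qg_dom (ip_norm qg_ip) g)) qg_emb_m ;
  qg_closable :
    functional (closure [set (qg_emb_p f, f) | f in qg_dom] : set (Bp * B0)) ;
  qg_injective :
    injective_rel (closure [set (qg_emb_p f, f) | f in qg_dom]
      : set (Bp * B0))
}.

Section Theory.
Variables (Bp B0 : hilbertType R) (Bm : completeNormedModType R[i]).
Variable G : quasi_gelfand_triple Bp B0 Bm.

(* The closed embedding of B+ into B0. Since D+ lives both in B+ and in B0,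
   [iota_p G (u, f)] reads: [u] belongs to D+, and is [f] as an element
   of B0. *)
Definition iota_p : set (Bp * B0) :=
  closure [set (qg_emb_p G f, f) | f in qg_dom G].

Definition Dminus : set B0 := dual_dom (qg_dom G) (ip_norm (qg_ip G)).

(* [iota_m G (w, g)] reads: [w] belongs to D-, and is [g] as an element
   of B0. *)
Definition iota_m : set (Bm * B0) :=
  [set (qg_emb_m G g, g) | g in Dminus].

Definition duality_map (Psi : {linear Bm -> Bp}) : Prop :=
  [/\ bijective Psi,
      forall w, `|Psi w| = `|w| &
      forall g, Dminus g -> adjoint iota_p (g, Psi (qg_emb_m G g))].

(* The operator [V1 V2], with domain D+ x D-, from B+ x B- to K. *)
Definition row_operator (K : hilbertType R) (V1 V2 : B0 -> K) :
    set ((Bp * Bm) * K) :=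
  [set p | exists f g, [/\ iota_p (p.1.1, f), iota_m (p.1.2, g) &
                           p.2 = V1 f + V2 g]].

Definition row_kernel (K : hilbertType R) (V1 V2 : B0 -> K) : set (B0 * B0) :=
  [set p | V1 p.1 + V2 p.2 = 0].

Definition boundary_domain (X K : hilbertType R) (A0 : set (X * X))
    (B1 : X -> Bp) (B2 : X -> Bm) (V1 V2 : B0 -> K) : set X :=
  [set a | dom (adjoint A0) a /\
     exists f g, [/\ iota_p (B1 a, f), iota_m (B2 a, g) & V1 f + V2 g = 0]].

End Theory.
End QuasiGelfand.

(* Main.v *)
Require Import Defs.
From HB Require Import structures.
From mathcomp Require Import all_boot all_order all_algebra.
From mathcomp Require Import complex.
From mathcomp Require Import all_classical all_reals all_analysis.
From mathcomp Require Import ring lra.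

Set Implicit Arguments.
Unset Strict Implicit.
Unset Printing Implicit Defensive.

Import Order.TTheory GRing.Theory Num.Theory.
Import numFieldNormedType.Exports.

Local Open Scope classical_set_scope.
Local Open Scope ring_scope.
Local Open Scope complex_scope.

(** Green's identity of the boundary triple turns the dissipativity of the
    relation on [B0] of hypothesis (ii) into that of [A]; the work lies in the
    range condition [ran (1 - h A) = X] for [h > 0], after which the
    Lumer-Phillips theorem applies.

    The range condition is obtained by exhibiting a dissipative linear relation
    [T] whose adjoint is contained in [A]. For any dissipative [T] one has
    [`|y| <= `|y - h t|] on [T], so for each [z] the map
    [y - h t |-> <y, z>] is a well defined bounded functional on
    [ran (1 - h T)]; the vector representing it solves [a - h T^* a = z]
    ([adjoint_range]).

    To find [T], write [V1^*], [V2^*] for the adjoints on [B0], and let [N] be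
    the set of all [(alpha, beta)] in [B+ x B+] such that, for some [k] in [K],
    [alpha = iota_+^* V1^* k] and [beta] is [V2^* k] seen in [B+]. This is the
    range of the adjoint of the row operator, transported by the duality map.
    Hypothesis (iii) gives [Re <alpha, beta> >= 0] on [N], because
    [<alpha, beta>] is the conjugate of [<V2^* k, V1^* k>]. Hence the
    restriction [T] of [- A0^*] to the vectors [y] with [(Psi B2 y, B1 y)] in
    [N] is dissipative by Green's identity. It contains [A0], since both
    boundary maps vanish on [dom A0], so that its adjoint is a restriction of
    [A0^*]; Green's identity and the surjectivity of the boundary maps show
    that [a] in [dom T^*] forces [(B1 a, Psi B2 a)] to be orthogonal to [N].
    As the row operator is closed, the orthogonal complement of the range of
    its adjoint is its kernel ([row_kernel_biorthogonal]), which is the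
    boundary condition defining [A].

    The isometry [Psi] transports everything that concerns [B-] to [B+]: by
    [iota_mE], a vector [w] of [B-] is [g] as an element of [B0] if and only if
    [iota_+^* g = Psi w].

    The semigroup is built by the implicit Euler scheme along dyadic meshes:
    [T(t) x] is the limit of [J_h^k x] for [h = 2^-n], [k = floor(t / h)] and
    [J_h = (1 - h A)^-1]. On [dom A^2] two half steps differ from a full one by
    [O(h^2)], so these approximations form a Cauchy sequence; each [J_h] is a
    contraction and [dom A^2] is dense, so they converge everywhere. Finally
    the generator of the limit is a dissipative extension of [A], and it equals
    [A] because [1 - A] is already onto.

    Everything is done with the real form [Re <x, y>]; for complex subspaces
    and complex relations, real orthogonality implies complex orthogonality. *)

(** * Projection and Riesz representation for real forms *)

Lemma discriminant_le (R : realFieldType) (a b c : R) : 0 <= c ->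
  (forall t, 0 <= a + 2 * t * b + t ^+ 2 * c) -> b ^+ 2 <= a * c.
Proof.
move=> c0 pos; have [c_eq0|cn0] := eqVneq c 0.
  suff -> : b = 0 by rewrite c_eq0 expr0n mulr0.
  apply: contrapT => /eqP bn0.
  have := pos (- (a + 1) / (2 * b)); rewrite c_eq0 mulr0 addr0.
  have -> : 2 * (- (a + 1) / (2 * b)) * b = - (a + 1) by field.
  by lra.
have := pos (- b / c).
have -> : a + 2 * (- b / c) * b + (- b / c) ^+ 2 * c = (a * c - b ^+ 2) / c.
  by field.
have cp : 0 < c by rewrite lt_def cn0.
by rewrite pmulr_lge0 ?invr_gt0// subr_ge0.
Qed.

Definition real_subspace (R : realType) (E : lmodType R[i]) (S : set E) :=
  S 0 /\ forall (t : R) x y, S x -> S y -> S (t%:C *: x + y).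

(** It stands for [Re <x, y>] on a Hilbert space and for the sums of such forms
    on products, where the norm of the product topology, a maximum, does not
    come from an inner product. *)
Record real_form (R : realType) (E : lmodType R[i]) (b : E -> E -> R) : Prop :=
  RealForm {
    rformDl : forall x y z, b (x + y) z = b x z + b y z ;
    rformZl : forall (t : R) x y, b (t%:C *: x) y = t * b x y ;
    rformC : forall x y, b x y = b y x ;
    form_ge0 : forall x, 0 <= b x x
  }.

Section RealForm.
Context {R : realType} {E : lmodType R[i]}.
Variable b : E -> E -> R.

Definition form_cvg (u : nat -> E) (l : E) : Prop :=
  forall e : R, 0 < e -> exists N, forall n, (N <= n)%N -> b (u n - l) (u n - l) < e.

Definition form_cauchy (u : nat -> E) : Prop :=
  forall e : R, 0 < e -> exists N, forall m n, (N <= m)%N -> (N <= n)%N ->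
    b (u m - u n) (u m - u n) < e.

Definition form_complete : Prop :=
  forall u, form_cauchy u -> exists l, form_cvg u l.

Definition adherent (S : set E) (m : E) : Prop :=
  forall e : R, 0 < e -> exists2 s, S s & b (s - m) (s - m) < e.

Hypothesis bP : real_form b.

Lemma rformDr x y z : b x (y + z) = b x y + b x z.
Proof. by rewrite (rformC bP) (rformDl bP) !(rformC bP _ x). Qed.

Lemma rformZr (t : R) x y : b x (t%:C *: y) = t * b x y.
Proof. by rewrite (rformC bP) (rformZl bP) (rformC bP). Qed.

Lemma rformNl x y : b (- x) y = - b x y.
Proof.
have -> : - x = (-1 : R)%:C *: x by rewrite rmorphN1 scaleN1r.
by rewrite (rformZl bP) mulN1r.
Qed.

Lemma rformNr x y : b x (- y) = - b x y.
Proof. by rewrite (rformC bP) rformNl (rformC bP). Qed.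

Definition rformE := ((rformDl bP), rformDr, (rformZl bP), rformZr, rformNl, rformNr).

Lemma form_cauchy_schwarz x y : b x y ^+ 2 <= b x x * b y y.
Proof.
apply: discriminant_le => [|t]; first exact: form_ge0.
have := form_ge0 bP (x + t%:C *: y); rewrite !rformE (rformC bP y x).
by congr (_ <= _); ring.
Qed.

(** The form is continuous by Cauchy-Schwarz, so orthogonality passes to limits. *)
Lemma adherent_orthogonal (S : set E) m x : adherent S m ->
  (forall s, S s -> b x s = 0) -> b x m = 0.
Proof.
move=> Sm xS; apply/eqP; rewrite -sqrf_eq0; apply/eqP/le_anti.
rewrite sqr_ge0 andbT; apply/ler_addgt0Pr => e e0; rewrite add0r.
have x1 : 0 < b x x + 1 by have := form_ge0 bP x; lra.
have [s Ss sm] := Sm _ (divr_gt0 e0 x1).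
have -> : b x m = - b x (s - m) by rewrite !rformE (xS s Ss); ring.
rewrite sqrrN (le_trans (form_cauchy_schwarz _ _))//.
have -> : e = (b x x + 1) * (e / (b x x + 1)) by field; rewrite gt_eqF.
apply: ler_pM; rewrite ?(form_ge0 bP)//; last exact: ltW.
by rewrite lerDl.
Qed.

(** A minimizing sequence for the distance from [p] to [S] is Cauchy by the
    parallelogram identity. Its limit is only adherent to [S], so that the
    statement also applies to subspaces that are not closed. *)
Theorem orthogonal_projection (S : set E) (p : E) :
  form_complete -> real_subspace S ->
  exists2 m, adherent S m & forall s, S s -> b (p - m) s = 0.
Proof.
move=> cplt [S0 Slin].
have SZ (t : R) x : S x -> S (t%:C *: x).
  by move=> Sx; rewrite -[_ *: _]addr0; exact: Slin.
have SD x y : S x -> S y -> S (x + y).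
  by move=> Sx Sy; have := Slin 1 _ _ Sx Sy; rewrite scale1r.
pose q x := b x x; pose D := [set q (p - s) | s in S].
have Dinf : has_inf D.
  split; first by exists (q (p - 0)), 0.
  by exists 0 => _ [s _ <-]; exact: (form_ge0 bP).
have [del [del0 inv_small]] : exists del : nat -> R, (forall n, 0 < del n) /\
    forall e : R, 0 < e -> exists N, forall n, (N <= n)%N -> del n < e.
  exists (fun n => n.+1%:R^-1); split=> [n|e e0]; first by rewrite invr_gt0.
  have [N _ NP] := near_infty_natSinv_lt (PosNum e0).
  by exists N => n Nn; exact: NP.
have [d dle near_d] : exists2 d, forall s, S s -> d <= q (p - s) &
    forall n : nat, exists s, S s /\ q (p - s) < d + del n.
  exists (inf D) => [s Ss|n].
    by apply: ge_inf; [exact: Dinf.2|exists s].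
  have /inf_adherent/(_ Dinf) := del0 n.
  by case=> _ [s Ss <-] lt; exists s.
have /choice[u uP] := near_d.
have uS n : S (u n) by case: (uP n).
have ud n : q (p - u n) < d + del n by case: (uP n).
(* parallelogram identity at the midpoint of two almost minimizers *)
have ucauchy : form_cauchy u.
  move=> e e0; have [N NP] := inv_small _ (divr_gt0 e0 (ltr0n R 4)).
  exists N => m n /NP Nm /NP Nn.
  have := dle _ (SZ (2^-1) _ (SD _ _ (uS m) (uS n))).
  have := ud m; have := ud n; rewrite /q !rformE.
  rewrite (rformC bP (u m) p) (rformC bP (u n) p) (rformC bP (u n) (u m)).
  lra.
have [l ul] := cplt _ ucauchy.
have Sl : adherent S l.
  by move=> e /ul[N NP]; exists (u N) => //; exact: NP.
exists l => // s Ss.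
(* minimality up to [del n] along the line [u n + t s] *)
have near_orth n : b (p - u n) s ^+ 2 <= del n * q s.
  apply: discriminant_le => [|t]; first exact: (form_ge0 bP).
  have := dle _ (Slin (- t) _ _ Ss (uS n)); have := ud n.
  rewrite /q !rformE (rformC bP s p) (rformC bP s (u n)) (rformC bP (u n) p); lra.
apply/eqP; rewrite -sqrf_eq0; apply/eqP/le_anti.
rewrite sqr_ge0 andbT; apply/ler_addgt0Pr => e e0; rewrite add0r.
have q1 : 0 < q s + 1 by have := form_ge0 bP s; rewrite /q; lra.
have e4 : 0 < e / (4 * (q s + 1)) by rewrite divr_gt0// mulr_gt0.
have [N1 N1P] := inv_small _ e4; have [N2 N2P] := ul _ e4.
pose n := maxn N1 N2.
have h1 := N1P n (leq_maxl _ _); have h2 := N2P n (leq_maxr _ _).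
have -> : b (p - l) s = b (p - u n) s + b (u n - l) s by rewrite !rformE; ring.
have cs := form_cauchy_schwarz (u n - l) s.
have sq (x y : R) : (x + y) ^+ 2 <= 2 * x ^+ 2 + 2 * y ^+ 2.
  by have := sqr_ge0 (x - y); nra.
apply: le_trans (sq _ _) _.
have qs := form_ge0 bP s; rewrite -/(q s) in qs cs.
have i1 : b (p - u n) s ^+ 2 <= e / (4 * (q s + 1)) * (q s + 1).
  apply: le_trans (near_orth n) _.
  by apply: ler_pM; rewrite ?lerDl// ltW.
have i2 : b (u n - l) s ^+ 2 <= e / (4 * (q s + 1)) * (q s + 1).
  apply: le_trans cs _.
  by apply: ler_pM; rewrite ?lerDl ?(form_ge0 bP)// ltW.
have E4 : e / (4 * (q s + 1)) * (q s + 1) = e / 4 by field; rewrite gt_eqF.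
by rewrite E4 in i1 i2; lra.
Qed.

(** The functional is given by its graph [L], so its domain may be a
    proper subspace. The representing vector is a multiple of the component of
    some [x1], not in the kernel, orthogonal to the kernel. *)
Theorem riesz_relation (L : set (E * R)) (M : R) :
  form_complete -> L (0, 0) ->
  (forall (t : R) p q, L p -> L q -> L (t%:C *: p.1 + q.1, t * p.2 + q.2)) ->
  (forall p, L p -> p.2 ^+ 2 <= M * b p.1 p.1) ->
  exists a, forall p, L p -> b a p.1 = p.2.
Proof.
move=> cplt L0 Llin Lbd.
have [all0|/existsNP[[x1 c1] /not_implyP[L1 /= /eqP c1n0]]] :=
    pselect (forall p, L p -> p.2 = 0).
  by exists 0 => p Lp; rewrite all0// -(scale0r (0 : E)) (rformZl bP) mul0r.
pose S := [set x | L (x, 0)].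
have Ssub : real_subspace S.
  by split=> // t x y Sx Sy; have := Llin t _ _ Sx Sy; rewrite /= mulr0 addr0.
have [m Sm orth] := orthogonal_projection x1 cplt Ssub.
have [n nE] : exists n, x1 - m = n by exists (x1 - m).
rewrite nE in orth.
have x1E : x1 = n + m by rewrite -nE subrK.
have M1 : 0 < `|M| + 1 by rewrite ltr_wpDl.
have nm : b n m = 0 by exact: adherent_orthogonal Sm orth.
(* [x1] is not adherent to the kernel, as the functional is bounded *)
have qn : b n n != 0.
  apply/eqP => qn0.
  have c2 : 0 < c1 ^+ 2 by rewrite lt_def sqr_ge0 sqrf_eq0 c1n0.
  have [s Ss sm] := Sm _ (divr_gt0 c2 (mulr_gt0 (ltr0n R 2) M1)).
  have := Lbd _ (Llin (-1) _ _ Ss L1); rewrite /= mulr0 add0r rmorphN1 scaleN1r.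
  apply/negP; rewrite -ltNge.
  have -> : - s + x1 = n + (m - s) by rewrite -nE addrA subrK addrC.
  have -> : b (n + (m - s)) (n + (m - s)) = b (s - m) (s - m).
    rewrite !rformE qn0 (rformC bP m n) (rformC bP s n) nm (orth s Ss).
    by rewrite (rformC bP m s); ring.
  have := form_ge0 bP (s - m) => q0.
  apply: (@le_lt_trans _ _ ((`|M| + 1) * b (s - m) (s - m))).
    by rewrite ler_wpM2r// (le_trans (ler_norm M))// lerDl.
  rewrite -ltr_pdivlMl//; apply: lt_le_trans sm _.
  have h : 0 <= (`|M| + 1)^-1 * c1 ^+ 2 by rewrite mulr_ge0 ?invr_ge0 ?ltW.
  have -> : c1 ^+ 2 / (2 * (`|M| + 1)) = (`|M| + 1)^-1 * c1 ^+ 2 / 2.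
    by field; rewrite gt_eqF.
  by rewrite ler_pdivrMr// ler_peMr// ler1n.
exists ((c1 / b n n)%:C *: n) => -[x c] Lx /=.
have := Llin (- (c / c1)) _ _ L1 Lx; rewrite /= mulNr divfK// addNr => /orth.
rewrite !rformE.
have -> : b n x1 = b n n by rewrite x1E rformDr nm addr0.
move=> h; have -> : b n x = c / c1 * b n n by lra.
by field; rewrite c1n0.
Qed.
End RealForm.

(** * Hilbert spaces through real norms and real forms *)

Section ComplexReal.
Context {R : realType}.
Implicit Types (z w : R[i]) (t : R).

Lemma ReD z w : complex.Re (z + w) = complex.Re z + complex.Re w.
Proof. by case: z; case: w. Qed.

Lemma Re_realM t z : complex.Re (t%:C * z) = t * complex.Re z.
Proof. by case: z => a b /=; rewrite mul0r subr0. Qed.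

Lemma Re_conj z : complex.Re (Num.conj z) = complex.Re z.
Proof. by case: z. Qed.

Lemma complex_Re_inj z w : complex.Re z = complex.Re w ->
  complex.Re ('i * z) = complex.Re ('i * w) -> z = w.
Proof.
case: z w => [a b] [c d] /= -> /eqP.
by rewrite !mul0r !mul1r !sub0r => /eqP/oppr_inj->.
Qed.
End ComplexReal.

Section RealNorm.
Context {R : realType} {V : normedModType R[i]}.
Implicit Types (x y : V) (t : R).

Lemma normE x : `|x| = (rnorm x)%:C.
Proof. by rewrite /rnorm RRe_real// ger0_real. Qed.

Lemma rnorm_ge0 x : 0 <= rnorm x.
Proof. by rewrite -ler0c -normE. Qed.

Lemma rnormN x : rnorm (- x) = rnorm x.
Proof. by rewrite /rnorm normrN. Qed.

Lemma rnormB x y : rnorm (x - y) = rnorm (y - x).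
Proof. by rewrite -rnormN opprB. Qed.

Lemma rnorm0 : rnorm (0 : V) = 0.
Proof. by rewrite /rnorm normr0. Qed.

Lemma rnormD x y : rnorm (x + y) <= rnorm x + rnorm y.
Proof. by rewrite -lecR rmorphD /= -!normE ler_normD. Qed.

Lemma rnormZc (a : R[i]) x : rnorm (a *: x) = complex.Re `|a| * rnorm x.
Proof.
by apply: complexI; rewrite rmorphM /= -!normE normrZ; congr (_ * _).
Qed.

Lemma rnormZ t x : rnorm (t%:C *: x) = `|t| * rnorm x.
Proof. by rewrite rnormZc normc_def /= expr0n addr0 sqrtr_sqr. Qed.

Lemma rnorm0_eq0 x : rnorm x = 0 -> x = 0.
Proof. by move=> x0; apply/eqP; rewrite -normr_eq0 normE x0. Qed.

Lemma norm_lt x t : (`|x| < t%:C) = (rnorm x < t).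
Proof. by rewrite normE ltcR. Qed.

Lemma rcvgP (T : Type) (F : set_system T) (FF : Filter F) (u : T -> V) (l : V) :
  u x @[x --> F] --> l <->
  forall e : R, 0 < e -> \forall x \near F, rnorm (l - u x) < e.
Proof.
rewrite cvgrPdist_lt; split=> [ul e e0|ul e].
  have /ul : (0 : R[i]) < e%:C by rewrite ltcR.
  by apply: filterS => x; rewrite norm_lt.
case: e => a b; rewrite ltcE /= => /andP[/eqP-> a0].
by apply: filterS (ul a a0) => x; rewrite -norm_lt.
Qed.

Lemma rclosureP (S : set V) x :
  closure S x <-> forall e : R, 0 < e -> exists2 s, S s & rnorm (s - x) < e.
Proof.
split=> [Sx e e0|Sx B /nbhs_normP[e]].
  have /Sx[s [Ss sB]] : nbhs x (ball_ Num.norm x e%:C).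
    by apply/nbhs_normP; exists e%:C => //=; rewrite ltcR.
  by exists s => //; rewrite rnormB -norm_lt.
case: e => a b; rewrite /= ltcE /= => /andP[/eqP-> a0] eB.
have [s Ss sx] := Sx a a0; exists s; split=> //; apply: eB.
by rewrite /= norm_lt rnormB.
Qed.

Lemma rdenseP (S : set V) : dense S ->
  forall x (e : R), 0 < e -> exists2 s, S s & rnorm (s - x) < e.
Proof.
move=> Sd x; apply/rclosureP => B /nbhs_interior xB.
have B0 : B° !=set0 by exists x; exact: nbhs_singleton.
have [s [Bs Ss]] := Sd _ B0 (@open_interior _ B).
by exists s; split=> //; exact: interior_subset.
Qed.
End RealNorm.

Lemma rnorm_pair (R : realType) (U V : normedModType R[i]) (p : U * V) (e : R) :
  (rnorm p < e) = (rnorm p.1 < e) && (rnorm p.2 < e).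
Proof. by rewrite -!norm_lt prod_normE comparable_gt_max// real_comparable ?normr_real. Qed.

Lemma rcauchy_cvg (R : realType) (V : completeNormedModType R[i])
    (u : nat -> V) :
  (forall e : R, 0 < e -> exists N, forall n, (N <= n)%N ->
    rnorm (u N - u n) < e) -> cvg (u n @[n --> \oo]).
Proof.
move=> uP; apply: cauchy_cvg; apply: cauchy_exP => -[a b].
rewrite ltcE /= => /andP[/eqP-> a0]; have [N NP] := uP _ a0.
by exists (u N); exists N => // n /NP; rewrite -ball_normE /ball_ /= norm_lt.
Qed.

Section HilbertForm.
Context {R : realType} {H : hilbertType R}.
Implicit Types (x y : H) (t : R).

Definition re_inner x y : R := complex.Re '[x, y].

Lemma innerC x y : '[x, y] = Num.conj '[y, x].
Proof. by rewrite hermC /= expr0 mul1r. Qed.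

Lemma re_inner_norm x : re_inner x x = rnorm x ^+ 2.
Proof. by rewrite /re_inner inner_norm normE -rmorphXn. Qed.

Lemma re_inner_form : real_form re_inner.
Proof.
split=> [x y z|t x y|x y|x].
- by rewrite /re_inner linearDl ReD.
- by rewrite /re_inner linearZl_LR Re_realM.
- by rewrite /re_inner innerC Re_conj.
- by rewrite re_inner_norm sqr_ge0.
Qed.

Lemma rnorm_cauchy_schwarz x y : `|re_inner x y| <= rnorm x * rnorm y.
Proof.
have := form_cauchy_schwarz re_inner_form x y.
rewrite !re_inner_norm -exprMn -real_normK ?num_real// ler_pXn2r//.
by rewrite nnegrE mulr_ge0// rnorm_ge0.
Qed.

Lemma re_inner_complete : form_complete re_inner.
Proof.
move=> u ucauchy.
have /rcauchy_cvg/cvg_ex[l /= /rcvgP ul] : forall e : R, 0 < e ->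
    exists N, forall n, (N <= n)%N -> rnorm (u N - u n) < e.
  move=> e e0; have [N NP] := ucauchy _ (exprn_gt0 2 e0).
  exists N => n Nn; have := NP _ _ (leqnn N) Nn.
  by rewrite re_inner_norm ltr_pXn2r ?nnegrE ?rnorm_ge0 ?ltW.
exists l => e e0; have sq : 0 < Num.sqrt e by rewrite sqrtr_gt0.
have [N _ NP] := ul _ sq; exists N => n /NP /= lt.
rewrite re_inner_norm -(sqr_sqrtr (ltW e0)) ltr_pXn2r ?nnegrE ?rnorm_ge0 ?sqrtr_ge0//.
by rewrite rnormB.
Qed.

Lemma re_inner_eq0 x : re_inner x x <= 0 -> x = 0.
Proof.
rewrite re_inner_norm => x0; apply/rnorm0_eq0/eqP.
by rewrite -sqrf_eq0; apply/eqP/le_anti; rewrite x0 sqr_ge0.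
Qed.

Lemma re_inner_ext x y : (forall w, re_inner x w = re_inner y w) -> x = y.
Proof.
move=> xy; apply/subr0_eq/re_inner_eq0.
by rewrite (rformDl re_inner_form) (rformNl re_inner_form) xy subrr.
Qed.
End HilbertForm.

(** An identity between real combinations of vectors is tested against an
    arbitrary vector, where it becomes an identity between real numbers. *)
Ltac vector_ring :=
  apply: re_inner_ext => ?; rewrite ?(rformE re_inner_form);
  first [ring | by field].

Ltac vector_from e :=
  let w := fresh "w" in let f := fresh "e" in
  apply: re_inner_ext => w; have f := congr1 (re_inner^~ w) e;
  rewrite /= ?(rformE re_inner_form) in f *; lra.

(** * Products of Hilbert spaces and adjoints *)

Section ProductForm.
Context {R : realType} {E F : lmodType R[i]}.
Variables (b : E -> E -> R) (c : F -> F -> R).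

Definition prod_form (p q : E * F) : R := b p.1 q.1 + c p.2 q.2.

Hypotheses (bP : real_form b) (cP : real_form c).

Lemma prod_form_form : real_form prod_form.
Proof.
split=> [x y z|t x y|x y|x]; rewrite /prod_form /=.
- by rewrite !(rformDl bP, rformDl cP) addrACA.
- by rewrite (rformZl bP) (rformZl cP) mulrDr.
- by rewrite (rformC bP) (rformC cP).
- by rewrite addr_ge0// ?(form_ge0 bP) ?(form_ge0 cP).
Qed.

Lemma prod_form_complete :
  form_complete b -> form_complete c -> form_complete prod_form.
Proof.
move=> bcplt ccplt u uC.
have [|l lP] := bcplt (fun n => (u n).1).
  move=> e /uC[N NP]; exists N => m n Nm Nn.
  apply: le_lt_trans (NP m n Nm Nn).
  by rewrite /prod_form lerDl (form_ge0 cP).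
have [|l' lP'] := ccplt (fun n => (u n).2).
  move=> e /uC[N NP]; exists N => m n Nm Nn.
  apply: le_lt_trans (NP m n Nm Nn).
  by rewrite /prod_form lerDr (form_ge0 bP).
exists (l, l') => e e0; have e2 : 0 < e / 2 by rewrite divr_gt0.
have [[N NP] [N' NP']] := (lP _ e2, lP' _ e2).
exists (maxn N N') => n; rewrite geq_max => /andP[/NP h /NP' h'].
by rewrite (splitr e) ltrD.
Qed.
End ProductForm.

Section HilbertAdherent.
Context {R : realType}.
Implicit Types H : hilbertType R.

Lemma re_inner_lt H (x : H) (e : R) : 0 < e ->
  (re_inner x x < e ^+ 2) = (rnorm x < e).
Proof.
by move=> e0; rewrite re_inner_norm ltr_pXn2r// nnegrE ?rnorm_ge0// ltW.
Qed.

Lemma adherent_closure H1 H2 (S : set (H1 * H2)) m :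
  adherent (prod_form re_inner re_inner) S m <-> closure S m.
Proof.
rewrite rclosureP; split=> Sm e e0.
  have [s Ss] := Sm _ (exprn_gt0 2 e0); rewrite /prod_form => lt.
  exists s => //; rewrite rnorm_pair -!re_inner_lt//.
  have := form_ge0 re_inner_form (s - m).1.
  have := form_ge0 re_inner_form (s - m).2.
  by move=> ? ?; apply/andP; split; apply: le_lt_trans lt; rewrite ?lerDl ?lerDr.
have e2 : 0 < Num.sqrt (e / 2) by rewrite sqrtr_gt0 divr_gt0.
have [s Ss] := Sm _ e2; rewrite rnorm_pair -!re_inner_lt// => /andP[].
rewrite sqr_sqrtr ?divr_ge0 ?ltW// => h h'.
by exists s => //; rewrite (splitr e) ltrD.
Qed.

Lemma closed_orthogonal_projection H1 H2 (S : set (H1 * H2)) p :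
  closed S -> real_subspace S ->
  exists2 m, S m & forall s, S s -> prod_form re_inner re_inner (p - m) s = 0.
Proof.
move=> Scl Ssub.
have cplt := prod_form_complete (@re_inner_form _ H1) (@re_inner_form _ H2)
  (@re_inner_complete _ H1) (@re_inner_complete _ H2).
have [m /adherent_closure Sm orth] := orthogonal_projection
  (prod_form_form re_inner_form re_inner_form) p cplt Ssub.
by exists m => //; exact: Scl.
Qed.
End HilbertAdherent.

Section Adjoints.
Context {R : realType}.
Implicit Types H : hilbertType R.

Lemma subspaceZ (U : lmodType R[i]) (S : set U) (a : R[i]) x :
  Defs.subspace S -> S x -> S (a *: x).
Proof. by case=> S0 Sl Sx; rewrite -[_ *: _]addr0; exact: Sl. Qed.

Lemma subspace_real (U : lmodType R[i]) (S : set U) :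
  Defs.subspace S -> real_subspace S.
Proof. by case=> S0 Sl; split=> // t x y; exact: Sl. Qed.

Lemma re_inner0 H (x : H) : re_inner 0 x = 0.
Proof. by rewrite /re_inner linear0l. Qed.

Lemma re_inner_cplx H1 H2 (x y : H1) (x' y' : H2) :
  re_inner x y = re_inner x' y' ->
  re_inner ('i *: x) y = re_inner ('i *: x') y' -> '[x, y] = '[x', y'].
Proof. by rewrite /re_inner !linearZl_LR; exact: complex_Re_inj. Qed.

(** Up to sign, the imaginary part of the adjoint relation at [p] is its real
    part at [i p]. *)
Lemma adjoint_re H1 H2 (S : set (H1 * H2)) q : Defs.subspace S ->
  (forall p, S p -> re_inner p.2 q.1 = re_inner p.1 q.2) -> adjoint S q.
Proof.
move=> Ssub Sq p Sp; apply: re_inner_cplx; first exact: Sq.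
exact: (Sq ('i *: p) (subspaceZ _ Ssub Sp)).
Qed.

Lemma adjoint_subspace H1 H2 (S : set (H1 * H2)) : Defs.subspace (adjoint S).
Proof.
split=> [p _|a x y Sx Sy p Sp] /=; first by rewrite !linear0r.
by rewrite !linearDr !linearZr_LR /= (Sx _ Sp) (Sy _ Sp).
Qed.

Lemma graph_subspace H1 H2 (f : {linear H1 -> H2}) : Defs.subspace (graph f).
Proof.
split; rewrite /graph /=; first by rewrite linear0.
by move=> a x y -> ->; rewrite linearP.
Qed.

(** Riesz representation of [x |-> Re <f x, k>] shows that the set from which
    [bounded_adjoint] picks is not empty. *)
Lemma bounded_adjointP H1 H2 (f : {linear H1 -> H2}) : bounded_operator f ->
  forall x k, '[f x, k] = '[x, bounded_adjoint f k].
Proof.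
move=> [M fM] x k.
suff [h hP] : exists h, adjoint (graph f) (k, h).
  have : adjoint (graph f) (k, bounded_adjoint f k) by
    exact: (@xgetPex _ 0 [set h | adjoint (graph f) (k, h)] (ex_intro _ h hP)).
  by move=> /(_ (x, f x) erefl).
have [|||a aP] := @riesz_relation _ _ _ (@re_inner_form _ H1)
  [set p | p.2 = re_inner (f p.1) k] (M ^+ 2 * rnorm k ^+ 2)
  (@re_inner_complete _ H1).
- by rewrite /= linear0 re_inner0.
- move=> t p q /= -> ->; rewrite linearD linearZ (rformDl re_inner_form).
  by rewrite (rformZl re_inner_form).
- move=> p /= ->; apply: le_trans (form_cauchy_schwarz re_inner_form _ _) _.
  rewrite !re_inner_norm.
  have -> : M ^+ 2 * rnorm k ^+ 2 * rnorm p.1 ^+ 2 =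
      (M * rnorm p.1) ^+ 2 * rnorm k ^+ 2 by ring.
  apply: ler_wpM2r; rewrite ?sqr_ge0//.
  rewrite ler_pXn2r ?nnegrE ?rnorm_ge0//.
  exact: le_trans (rnorm_ge0 _) (fM _).
exists a; apply: adjoint_re (graph_subspace f) _ => p /= ->.
by rewrite (rformC re_inner_form p.1) (aP (p.1, re_inner (f p.1) k)).
Qed.
End Adjoints.

(** * Resolvents of maximal dissipative relations *)

Section Resolvent.
Context {R : realType} {X : hilbertType R}.
Variable A : set (X * X).

Definition m_dissipative : Prop :=
  [/\ Defs.subspace A, dissipative A &
      forall (h : R) z, 0 < h -> exists2 p, A p & p.1 - h%:C *: p.2 = z].

Definition resolvent (h : R) (z : X) : X :=
  xget 0 [set x | exists2 y, A (x, y) & x - h%:C *: y = z].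

Hypothesis Amd : m_dissipative.

Let Asub : Defs.subspace A. Proof. by case: Amd. Qed.

Let AD (a : R[i]) p q : A p -> A q -> A (a *: p + q).
Proof. by case: Asub => _; apply. Qed.

(** The cross term in the expansion of the square of the right-hand side is
    [- 2 h Re <p.1, p.2> >= 0]. *)
Lemma dissipative_expansive (D : set (X * X)) (h : R) p :
  dissipative D -> 0 <= h -> D p -> rnorm p.1 <= rnorm (p.1 - h%:C *: p.2).
Proof.
move=> Ddis h0 /Ddis; rewrite -/(re_inner _ _) => dis.
rewrite -(@ler_pXn2r _ 2) ?nnegrE ?rnorm_ge0// -!re_inner_norm.
rewrite !(rformE re_inner_form) (rformC re_inner_form p.2).
have := form_ge0 re_inner_form (h%:C *: p.2).
rewrite !(rformE re_inner_form); nra.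
Qed.

Section Step.
Variable h : R.
Hypothesis h0 : 0 < h.
Local Notation J := (resolvent h).

Lemma resolventP z : exists2 y, A (J z, y) & J z - h%:C *: y = z.
Proof.
apply: (@xgetPex _ 0 [set x | exists2 y, A (x, y) & x - h%:C *: y = z]).
by case: Amd => _ _ /(_ h z h0)[[x y] Axy xyz]; exists x, y.
Qed.

Lemma resolventK x y : A (x, y) -> J (x - h%:C *: y) = x.
Proof.
move=> Axy; have [y' Ay' e] := resolventP (x - h%:C *: y).
move: (J _) Ay' e => x' Ay' e; apply/eqP; rewrite -subr_eq0; apply/eqP.
apply/rnorm0_eq0/le_anti; rewrite rnorm_ge0 andbT.
have Ad : A (x' - x, y' - y).
  by have := AD (-1) Axy Ay'; rewrite scaleN1r addrC.
have Adis : dissipative A by case: Amd.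
have := dissipative_expansive Adis (ltW h0) Ad.
suff -> : x' - x - h%:C *: (y' - y) = x' - x' by rewrite subrr rnorm0.
by vector_from e.
Qed.

Lemma resolvent_linear (a : R[i]) x y : J (a *: x + y) = a *: J x + J y.
Proof.
have [x' Ax ex] := resolventP x; have [y' Ay ey] := resolventP y.
rewrite -{1}ex -{1}ey scalerBr addrACA -opprD scalerA mulrC -scalerA -scalerDr.
exact: resolventK (AD a Ax Ay).
Qed.

Lemma resolvent_contraction x : rnorm (J x) <= rnorm x.
Proof.
have [x' Ax ex] := resolventP x; rewrite -{2}ex.
have Adis : dissipative A by case: Amd.
exact: (dissipative_expansive Adis (ltW h0) Ax).
Qed.

(** The resolvent equation [J x - x = h A J x = h J A x]. *)
Lemma resolventE x y : A (x, y) -> J x = x + h%:C *: J y.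
Proof.
move=> Axy; have -> : x = h%:C *: y + (x - h%:C *: y) by rewrite addrC subrK.
by rewrite resolvent_linear (resolventK Axy); vector_ring.
Qed.

Lemma resolvent_inv x y : A (x, y) -> A (J x, J y).
Proof.
move=> Axy; have [x' Ax ex] := resolventP x.
suff <- : x' = J y by [].
apply: (@scalerI _ _ (h%:C)); first by rewrite (fmorph_eq0 (real_complex R)) gt_eqF.
by move: ex; rewrite (resolventE Axy) => e; vector_from e.
Qed.

Lemma iter_linear n (a : R[i]) x y :
  iter n J (a *: x + y) = a *: iter n J x + iter n J y.
Proof. by elim: n => //= n ->; rewrite resolvent_linear. Qed.

Lemma iterB n x y : iter n J (x - y) = iter n J x - iter n J y.
Proof. by have := iter_linear n (-1) y x; rewrite !scaleN1r !(addrC (- _)). Qed.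

Lemma iter_contraction n x : rnorm (iter n J x) <= rnorm x.
Proof. by elim: n => //= n; apply: le_trans (resolvent_contraction _). Qed.

Lemma iter_inv n x y : A (x, y) -> A (iter n J x, iter n J y).
Proof. by move=> Axy; elim: n => //= n; exact: resolvent_inv. Qed.

Lemma iter_step n x y : A (x, y) ->
  iter n.+1 J x = iter n J x + h%:C *: iter n.+1 J y.
Proof. by move=> Axy; exact: resolventE (iter_inv n Axy). Qed.

Lemma iter_drift m n x y : A (x, y) ->
  rnorm (iter (m + n) J x - iter m J x) <= n%:R * h * rnorm y.
Proof.
move=> Axy; elim: n => [|n ih]; first by rewrite addn0 subrr rnorm0 !mul0r.
rewrite addnS (iter_step _ Axy) addrAC.
apply: le_trans (rnormD _ _) _.
rewrite rnormZ gtr0_norm// -natr1 !mulrDl mul1r lerD// (ler_wpM2l (ltW h0))//.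
exact: iter_contraction.
Qed.

(** Each step adds [h J^(k+1) y], and [J^(k+1) y] is close to [y]; as [y] need
    not lie in the domain, its drift is estimated through an approximation [z]
    which does. *)
Lemma iter_linearization n x y z z' : A (x, y) -> A (z, z') ->
  rnorm (iter n J x - x - (n%:R * h)%:C *: y) <=
  n%:R * h * (2 * rnorm (y - z) + n%:R * h * rnorm z').
Proof.
move=> Axy Az; elim: n => [|n ih].
  by rewrite subrr mul0r scale0r subr0 rnorm0 mul0r.
have slope : rnorm (iter n.+1 J y - y) <=
    2 * rnorm (y - z) + n.+1%:R * h * rnorm z'.
  have -> : iter n.+1 J y - y =
      iter n.+1 J (y - z) + (iter (0 + n.+1) J z - iter 0 J z) + (z - y).
    by rewrite iterB add0n [iter 0 _ _]/=; vector_ring.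
  apply: le_trans (rnormD _ _) _; apply: le_trans (lerD (rnormD _ _) (lexx _)) _.
  have := iter_drift 0 n.+1 Az; have := iter_contraction n.+1 (y - z).
  rewrite (rnormB z); lra.
have -> : iter n.+1 J x - x - (n.+1%:R * h)%:C *: y =
    (iter n J x - x - (n%:R * h)%:C *: y) + h%:C *: (iter n.+1 J y - y).
  by rewrite (iter_step _ Axy) -natr1; vector_ring.
apply: le_trans (rnormD _ _) _; rewrite rnormZ gtr0_norm//.
have n0 : (0 : R) <= n%:R by [].
have nn := rnorm_ge0 z'; have ny := rnorm_ge0 (y - z).
move: ih slope; rewrite -natr1 => ih slope.
apply: le_trans (lerD ih (ler_wpM2l (ltW h0) slope)) _.
have : 0 <= n%:R * h * (h * rnorm z') by rewrite !mulr_ge0// ltW.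
nra.
Qed.
End Step.

(** With [v = J_(h/2)^2 x], one has [x = (1 - (h/2) A)^2 v], that is
    [x = (v - h A v) + (h^2/4) A^2 v]; apply [J_h] to both sides. *)
Lemma resolvent_halving (h : R) x x' x'' : 0 < h -> A (x, x') -> A (x', x'') ->
  rnorm (resolvent h x - iter 2 (resolvent (h / 2)) x) <= h ^+ 2 / 4 * rnorm x''.
Proof.
move=> h0 Ax Ax'; have h2 : 0 < h / 2 by rewrite divr_gt0.
set I := resolvent (h / 2).
have Av : A (I (I x), I (I x')) by do 2!apply: resolvent_inv => //.
have xE : x = (h ^+ 2 / 4)%:C *: I (I x'') + (I (I x) - h%:C *: I (I x')).
  have := resolventE h2 Ax; have := resolventE h2 (resolvent_inv h2 Ax).
  have := resolventE h2 (resolvent_inv h2 Ax'); rewrite -/I.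
  move: (I (I x'')) (I (I x')) (I x') (I (I x)) (I x) => v'' v' u' v u.
  move=> -> -> ->; vector_ring.
rewrite {1}xE (resolvent_linear h0) (resolventK h0 Av) /= addrK rnormZ.
rewrite ger0_norm ?divr_ge0 ?sqr_ge0// ler_wpM2l ?divr_ge0 ?sqr_ge0//.
apply: le_trans (resolvent_contraction h0 _) _.
by do 2!apply: le_trans (resolvent_contraction h2 _) _.
Qed.

Lemma iter_halving (h : R) n x x' x'' : 0 < h -> A (x, x') -> A (x', x'') ->
  rnorm (iter n (resolvent h) x - iter n.*2 (resolvent (h / 2)) x) <=
  n%:R * (h ^+ 2 / 4 * rnorm x'').
Proof.
move=> h0 Ax Ax'; have h2 : 0 < h / 2 by rewrite divr_gt0.
elim: n => [|n ih]; first by rewrite /= subrr rnorm0 mul0r.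
rewrite doubleS; set y := iter n.*2 (resolvent (h / 2)) x in ih *.
have -> : iter n.+1 (resolvent h) x - iter n.*2.+2 (resolvent (h / 2)) x =
  resolvent h (iter n (resolvent h) x - y) +
  (resolvent h y - iter 2 (resolvent (h / 2)) y).
  by have := iterB h0 1 (iter n (resolvent h) x) y => /= ->; vector_ring.
apply: le_trans (rnormD _ _) _; rewrite -(natr1 n) mulrDl mul1r lerD//.
  exact: le_trans (resolvent_contraction h0 _) ih.
apply: le_trans (resolvent_halving h0 (iter_inv h2 _ Ax) (iter_inv h2 _ Ax')) _.
by rewrite ler_wpM2l ?divr_ge0 ?sqr_ge0//; exact: iter_contraction.
Qed.
End Resolvent.

(** * The implicit Euler scheme on dyadic meshes *)

Section Euler.
Context {R : realType}.
Implicit Types (s t : R) (n : nat).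

Definition mesh n : R := 2^-1 ^+ n.

(** The absolute value only serves to give a value at negative times. *)
Definition nsteps n t : nat := Num.trunc (`|t| / mesh n).

Lemma mesh_gt0 n : 0 < mesh n.
Proof. by rewrite exprn_gt0// invr_gt0. Qed.

Lemma meshS n : mesh n.+1 = mesh n / 2.
Proof. by rewrite /mesh exprSr. Qed.

Lemma mesh_small (e : R) : 0 < e ->
  exists N, forall n, (N <= n)%N -> mesh n < e.
Proof.
move=> e0; have : mesh n @[n --> \oo] --> (0 : R).
  by apply: cvg_expr; rewrite ger0_norm ?invr_ge0// invf_lt1// ltr1n.
move=> /cvgrPdist_lt /(_ e e0)[N _ NP]; exists N => n /NP /=.
by rewrite sub0r normrN gtr0_norm ?mesh_gt0.
Qed.

Lemma nsteps_itv n t :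
  (nsteps n t)%:R * mesh n <= `|t| < (nsteps n t).+1%:R * mesh n.
Proof.
have t0 : 0 <= `|t| / mesh n by rewrite divr_ge0// ltW// mesh_gt0.
have /andP[] := trunc_itv t0.
by rewrite ler_pdivlMr ?mesh_gt0// ltr_pdivrMr ?mesh_gt0// => -> ->.
Qed.

Lemma nsteps_bounds n t (k : nat) :
  (k%:R * mesh n <= `|t| -> (k <= nsteps n t)%N) /\
  (`|t| < k%:R * mesh n -> (nsteps n t < k)%N).
Proof.
have /andP[le lt] := nsteps_itv n t; have h0 : (0 : R) < mesh n := mesh_gt0 n.
split=> [kt|tk]; last by rewrite -(ltr_nat R) -(ltr_pM2r h0) (le_lt_trans le).
by rewrite -ltnS -(ltr_nat R) -(ltr_pM2r h0) (le_lt_trans kt).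
Qed.

Lemma nsteps_halving n t :
  exists2 j, (j <= 1)%N & nsteps n.+1 t = ((nsteps n t).*2 + j)%N.
Proof.
have /andP[le lt] := nsteps_itv n t; set k := nsteps n t in le lt *.
have [+ _] := nsteps_bounds n.+1 t k.*2; have [_] := nsteps_bounds n.+1 t k.*2.+2.
rewrite meshS -!doubleS -!mul2n !natrM => h1 h2.
have {}h1 : (nsteps n.+1 t < 2 * k.+1)%N by apply: h1; lra.
have {}h2 : (2 * k <= nsteps n.+1 t)%N by apply: h2; lra.
exists (nsteps n.+1 t - 2 * k)%N; last by rewrite subnKC.
by rewrite leq_subLR addn1 -ltnS; rewrite mulnS in h1.
Qed.

Lemma nstepsD n s t : 0 <= s -> 0 <= t ->
  exists2 j, (j <= 1)%N & nsteps n (s + t) = (nsteps n s + nsteps n t + j)%N.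
Proof.
move=> s0 t0; have := nsteps_itv n s; have := nsteps_itv n t.
rewrite !ger0_norm// => /andP[le lt] /andP[le' lt'].
set k := nsteps n t in le lt *; set k' := nsteps n s in le' lt' *.
have [+ _] := nsteps_bounds n (s + t) (k' + k)%N.
have [_] := nsteps_bounds n (s + t) (k'.+1 + k.+1)%N.
rewrite !ger0_norm ?addr_ge0// !natrD => h1 h2.
have {}h1 : (nsteps n (s + t) < k'.+1 + k.+1)%N by apply: h1; lra.
have {}h2 : (k' + k <= nsteps n (s + t))%N by apply: h2; lra.
exists (nsteps n (s + t) - (k' + k))%N; last by rewrite subnKC.
by rewrite leq_subLR addn1 -ltnS; rewrite addSn addnS in h1.
Qed.

Lemma nsteps_dist n s t : `|s| <= `|t| ->
  exists2 j, j%:R * mesh n <= `|t| - `|s| + mesh n &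
    nsteps n t = (nsteps n s + j)%N.
Proof.
move=> st; have /andP[le lt] := nsteps_itv n s.
have /andP[le' lt'] := nsteps_itv n t.
have kk : (nsteps n s <= nsteps n t)%N.
  by apply: (nsteps_bounds n t _).1; exact: le_trans st.
exists (nsteps n t - nsteps n s)%N; last by rewrite subnKC.
rewrite natrB//; move: lt; rewrite -natr1; lra.
Qed.
End Euler.

(** * The contraction semigroup and its generator *)

Section Semigroup.
Context {R : realType} {X : hilbertType R}.
Variable A : set (X * X).
Hypotheses (Amd : m_dissipative A) (Adense : dense (dom A)).
Implicit Types (s t e : R) (x y z : X) (n : nat).

Definition euler n t x : X := iter (nsteps n t) (resolvent A (mesh n)) x.

Definition semigroup t x : X := lim (euler n t x @[n --> \oo]).

Lemma euler_linear n t (a : R[i]) x y :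
  euler n t (a *: x + y) = a *: euler n t x + euler n t y.
Proof. exact: (iter_linear Amd (mesh_gt0 n)). Qed.

Lemma eulerB n t x y : euler n t (x - y) = euler n t x - euler n t y.
Proof. exact: (iterB Amd (mesh_gt0 n)). Qed.

Lemma euler_contraction n t x : rnorm (euler n t x) <= rnorm x.
Proof. exact: (iter_contraction Amd (mesh_gt0 n)). Qed.

(** Halving the mesh doubles the number of steps, up to one extra half step
    that costs [h/2 * |A x|]. *)
Lemma euler_succ n t x x' x'' : A (x, x') -> A (x', x'') ->
  rnorm (euler n t x - euler n.+1 t x) <= mesh n * (`|t| * rnorm x'' + rnorm x').
Proof.
move=> Ax Ax'; rewrite /euler; have [j j1 ->] := nsteps_halving n t.
have /andP[kt _] := nsteps_itv n t; have h0 : (0 : R) < mesh n := mesh_gt0 n.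
have h2 : (0 : R) < mesh n / 2 by rewrite divr_gt0.
rewrite meshS; set k := nsteps n t in kt *; set I := resolvent A (mesh n / 2).
have -> : iter k (resolvent A (mesh n)) x - iter (k.*2 + j) I x =
  (iter k (resolvent A (mesh n)) x - iter k.*2 I x) -
  (iter (k.*2 + j) I x - iter k.*2 I x) by vector_ring.
apply: le_trans (rnormD _ _) _; rewrite rnormN.
apply: le_trans (lerD (iter_halving Amd k h0 Ax Ax') (iter_drift Amd h2 _ j Ax)) _.
have n1 := rnorm_ge0 x'; have n2 := rnorm_ge0 x''.
have j1' : (j%:R : R) <= 1 by rewrite lern1.
have b1 : k%:R * mesh n * (mesh n / 4 * rnorm x'') <=
    `|t| * (mesh n / 4 * rnorm x'').
  by rewrite ler_wpM2r// mulr_ge0// divr_ge0// ltW.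
have b2 : j%:R * (mesh n / 2 * rnorm x') <= 1 * (mesh n / 2 * rnorm x').
  by rewrite ler_wpM2r// mulr_ge0// ltW.
have p1 : 0 <= mesh n * (`|t| * rnorm x'') by rewrite !mulr_ge0// ltW.
have p2 : 0 <= mesh n * rnorm x' by rewrite mulr_ge0// ltW.
nra.
Qed.

(** The bounds of [euler_succ] form a geometric series. *)
Lemma euler_cauchy n p t x x' x'' : A (x, x') -> A (x', x'') ->
  rnorm (euler n t x - euler (n + p) t x) <=
  2 * (mesh n - mesh (n + p)) * (`|t| * rnorm x'' + rnorm x').
Proof.
move=> Ax Ax'; elim: p => [|p ih].
  by rewrite addn0 !subrr rnorm0 mulr0 mul0r.
have -> : euler n t x - euler (n + p.+1) t x =
  (euler n t x - euler (n + p) t x) +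
  (euler (n + p) t x - euler (n + p).+1 t x) by rewrite addnS; vector_ring.
apply: le_trans (rnormD _ _) _.
apply: le_trans (lerD ih (euler_succ _ _ Ax Ax')) _.
by rewrite addnS meshS; lra.
Qed.

(** Resolvents map [dom A] into [dom A^2] and tend to the identity on it. *)
Lemma dom_sqr_dense x e : 0 < e ->
  exists a a' a'', [/\ A (a, a'), A (a', a'') & rnorm (a - x) < e].
Proof.
move=> e0; have e2 : 0 < e / 2 by rewrite divr_gt0.
have [a [a' Aa] ax] := rdenseP Adense x e2.
pose h := e / 2 / (rnorm a' + 1).
have n1 : 0 < rnorm a' + 1 by rewrite ltr_wpDl ?rnorm_ge0.
have h0 : 0 < h by rewrite divr_gt0.
have [a'' Aa'' _] := resolventP Amd h0 a'.
exists (resolvent A h a), (resolvent A h a'), a''; split=> //.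
  exact: (resolvent_inv Amd h0 Aa).
have -> : resolvent A h a - x = (iter (0 + 1) (resolvent A h) a - a) + (a - x).
  by rewrite /=; vector_ring.
apply: le_lt_trans (rnormD _ _) _; rewrite [ltRHS](splitr e) ler_ltD//.
apply: le_trans (iter_drift Amd h0 0 1 Aa) _.
rewrite mul1r /h -mulrA ger_pMr// mulrC ler_pdivrMr// mul1r; lra.
Qed.

Lemma euler_cvg t x : euler n t x @[n --> \oo] --> semigroup t x.
Proof.
apply: rcauchy_cvg => e e0; have e4 : 0 < e / 4 by rewrite divr_gt0.
have [a [a' [a'' [Aa Aa' ax]]]] := dom_sqr_dense x e4.
set C := `|t| * rnorm a'' + rnorm a'.
have C0 : 0 <= C by rewrite addr_ge0// ?mulr_ge0// rnorm_ge0.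
have C1 : 0 < C + 1 by rewrite ltr_wpDl.
have [N NP] := mesh_small (divr_gt0 e4 C1); exists N => n Nn.
have -> : euler N t x - euler n t x =
    euler n t (a - x) - euler N t (a - x) + (euler N t a - euler n t a).
  by rewrite !eulerB; vector_ring.
apply: le_lt_trans (rnormD _ _) _.
apply: le_lt_trans (lerD (rnormD _ _) (lexx _)) _; rewrite rnormN.
have c1 := le_lt_trans (euler_contraction n t (a - x)) ax.
have c2 := le_lt_trans (euler_contraction N t (a - x)) ax.
have := euler_cauchy N (n - N) t Aa Aa'; rewrite subnKC// -/C => c3.
have := NP N (leqnn N); rewrite ltr_pdivlMr// => c4.
have m1 := mesh_gt0 (R := R) N; have m2 := mesh_gt0 (R := R) n.
have : 0 <= mesh n * C by rewrite mulr_ge0// ltW.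
nra.
Qed.

(** Rounding times to the mesh costs a multiple of the mesh size, which
    disappears in the limit. *)
Lemma cvg_rnorm_le (u : nat -> X) (l : X) (c d : R) :
  u n @[n --> \oo] --> l -> (forall n, rnorm (u n) <= c + d * mesh n) ->
  rnorm l <= c.
Proof.
move=> /rcvgP ul uc; apply/ler_addgt0Pr => e e0.
have e2 : 0 < e / 2 by rewrite divr_gt0.
have d1 : 0 < `|d| + 1 by rewrite ltr_wpDl.
have [N1 _ N1P] := ul _ e2; have [N2 N2P] := mesh_small (divr_gt0 e2 d1).
pose n := maxn N1 N2.
have /= h1 := N1P n (leq_maxl _ _); have := N2P n (leq_maxr _ _).
rewrite ltr_pdivlMr// => h2; have h3 := uc n.
have -> : l = (l - u n) + u n by rewrite subrK.
apply: le_trans (rnormD _ _) _.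
have h4 : d * mesh n <= `|d| * mesh n.
  by rewrite ler_wpM2r ?ler_norm// ltW// mesh_gt0.
have := mesh_gt0 (R := R) n; lra.
Qed.

Lemma semigroup_linear t (a : R[i]) x y :
  semigroup t (a *: x + y) = a *: semigroup t x + semigroup t y.
Proof.
apply: cvg_lim; first exact: norm_hausdorff.
under eq_fun do rewrite euler_linear.
by apply: cvgD; [apply: cvgZr|]; exact: euler_cvg.
Qed.

Lemma semigroupB t x y : semigroup t (x - y) = semigroup t x - semigroup t y.
Proof.
by have := semigroup_linear t (-1) y x; rewrite !scaleN1r !(addrC (- _)).
Qed.

Lemma semigroup_contraction t x : rnorm (semigroup t x) <= rnorm x.
Proof.
apply: (@cvg_rnorm_le _ _ _ 0 (@euler_cvg t x)) => n.
by rewrite mul0r addr0; exact: euler_contraction.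
Qed.

Lemma semigroup0 x : semigroup 0 x = x.
Proof.
apply: cvg_lim; first exact: norm_hausdorff.
have -> : (fun n => euler n 0 x) = fun=> x.
  apply/funext => n; rewrite /euler; suff -> : nsteps n (0 : R) = 0%N by [].
  apply/eqP; rewrite -leqn0 -ltnS; apply: (nsteps_bounds n (0 : R) 1).2.
  by rewrite normr0 mul1r mesh_gt0.
exact: cvg_cst.
Qed.

Lemma semigroup_lipschitz s t x y : A (x, y) ->
  rnorm (semigroup t x - semigroup s x) <= `|t - s| * rnorm y.
Proof.
move=> Axy; wlog st : s t / `|s| <= `|t|.
  by move=> W; have [/W//|/ltW/W] := leP `|s| `|t|; rewrite rnormB distrC.
apply: le_trans (ler_wpM2r (rnorm_ge0 _) (lerB_dist t s)).
apply: (@cvg_rnorm_le _ _ _ (rnorm y)).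
  by apply: cvgB; exact: euler_cvg.
move=> n; have [j jst e] := nsteps_dist n st.
rewrite /euler e; apply: le_trans (iter_drift Amd (mesh_gt0 n) _ _ Axy) _.
by rewrite (mulrC (rnorm y)) -mulrDl ler_wpM2r ?rnorm_ge0.
Qed.

Lemma contraction_ext (f g : X -> X) :
  (forall x y, rnorm (f x - f y) <= rnorm (x - y)) ->
  (forall x y, rnorm (g x - g y) <= rnorm (x - y)) ->
  (forall x, dom A x -> f x = g x) -> f =1 g.
Proof.
move=> fc gc fg x; apply/eqP; rewrite -subr_eq0; apply/eqP/rnorm0_eq0/le_anti.
rewrite rnorm_ge0 andbT; apply/ler_addgt0Pr => e e0; rewrite add0r.
have e2 : 0 < e / 2 by rewrite divr_gt0.
have [a Aa ax] := rdenseP Adense x e2.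
have -> : f x - g x = (f x - f a) - (g x - g a) by rewrite (fg a Aa); vector_ring.
apply: le_trans (rnormD _ _) _; rewrite rnormN.
have := fc x a; have := gc x a; rewrite (rnormB x); lra.
Qed.

Lemma semigroupD s t x : 0 <= s -> 0 <= t ->
  semigroup (s + t) x = semigroup s (semigroup t x).
Proof.
move=> s0 t0; move: x; apply: contraction_ext => [x y|x y|x [y Axy]].
- by rewrite -semigroupB; exact: semigroup_contraction.
- by rewrite -!semigroupB !(le_trans (semigroup_contraction _ _)).
apply/eqP; rewrite -subr_eq0; apply/eqP/rnorm0_eq0/le_anti.
rewrite rnorm_ge0 andbT.
have T2 : euler n s (euler n t x) @[n --> \oo] --> semigroup s (semigroup t x).
  apply/rcvgP => e e0; have e2 : 0 < e / 2 by rewrite divr_gt0.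
  have /rcvgP/(_ _ e2) c1 := @euler_cvg s (semigroup t x).
  have /rcvgP/(_ _ e2) := @euler_cvg t x.
  apply: filterS2 c1 => n c1 c2.
  have -> : semigroup s (semigroup t x) - euler n s (euler n t x) =
      semigroup s (semigroup t x) - euler n s (semigroup t x) +
      euler n s (semigroup t x - euler n t x) by rewrite eulerB; vector_ring.
  apply: le_lt_trans (rnormD _ _) _; rewrite (splitr e) ltrD//.
  exact: le_lt_trans (euler_contraction _ _ _) c2.
have diff : (euler n (s + t) x - euler n s (euler n t x)) @[n --> \oo] -->
    semigroup (s + t) x - semigroup s (semigroup t x).
  by apply: cvgB T2; exact: euler_cvg.
apply: (@cvg_rnorm_le _ _ _ (rnorm y) diff) => n.
rewrite /euler add0r -iterD; have [j j1 ->] := nstepsD n s0 t0.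
apply: le_trans (iter_drift Amd (mesh_gt0 n) _ _ Axy) _.
rewrite (mulrC (rnorm y)) ler_wpM2r ?rnorm_ge0// ger_pMl ?mesh_gt0//.
by rewrite lern1.
Qed.

Lemma semigroup_continuous x : continuous (semigroup^~ x).
Proof.
move=> t; apply/rcvgP => e e0; have e4 : 0 < e / 4 by rewrite divr_gt0.
have [a [b Aab] ax] := rdenseP Adense x e4.
have b1 : 0 < rnorm b + 1 by rewrite ltr_wpDl ?rnorm_ge0.
have : \forall s \near t, `|t - s| < e / 4 / (rnorm b + 1).
  by apply/nbhs_normP; exists (e / 4 / (rnorm b + 1)) => //=; exact: divr_gt0.
apply: filterS => s; rewrite ltr_pdivlMr// => ts.
have -> : semigroup t x - semigroup s x = semigroup s (a - x) -
    semigroup t (a - x) + (semigroup t a - semigroup s a).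
  by rewrite !semigroupB; vector_ring.
apply: le_lt_trans (rnormD _ _) _.
apply: le_lt_trans (lerD (rnormD _ _) (lexx _)) _; rewrite rnormN.
have c1 := le_lt_trans (semigroup_contraction s (a - x)) ax.
have c2 := le_lt_trans (semigroup_contraction t (a - x)) ax.
have c3 := semigroup_lipschitz s t Aab; have := normr_ge0 (t - s).
nra.
Qed.

Definition semigroup_map t : {linear X -> X} :=
  HB.pack (semigroup t)
    (GRing.isLinear.Build R[i] X X *:%R (semigroup t) (semigroup_linear t)).

Lemma semigroup_linearization t x y z z' : 0 <= t -> A (x, y) -> A (z, z') ->
  rnorm (semigroup t x - x - t%:C *: y) <=
  t * (2 * rnorm (y - z) + t * rnorm z').
Proof.
move=> t0 Axy Az.
have lim : (euler n t x - (x + t%:C *: y)) @[n --> \oo] -->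
    semigroup t x - (x + t%:C *: y).
  by apply: cvgB; [exact: euler_cvg|exact: cvg_cst].
rewrite -addrA -opprD.
apply: (@cvg_rnorm_le _ _ _ (rnorm y) lim) => n.
have /andP[] := nsteps_itv n t; rewrite ger0_norm// /euler.
set k := nsteps n t; rewrite -natr1 mulrDl mul1r => le lt.
have -> : iter k (resolvent A (mesh n)) x - (x + t%:C *: y) =
    (iter k (resolvent A (mesh n)) x - x - (k%:R * mesh n)%:C *: y) -
    (t - k%:R * mesh n)%:C *: y.
  by vector_ring.
apply: le_trans (rnormD _ _) _.
apply: le_trans (lerD (iter_linearization Amd (mesh_gt0 n) k Axy Az) (lexx _)) _.
rewrite rnormN rnormZ ger0_norm ?subr_ge0//; apply: lerD.
  have kh : 0 <= k%:R * mesh n :> R by rewrite mulr_ge0// ltW// mesh_gt0.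
  apply: ler_pM => //; last by rewrite lerD2l ler_wpM2r ?rnorm_ge0.
  by rewrite addr_ge0// mulr_ge0// rnorm_ge0.
by rewrite mulrC ler_wpM2l ?rnorm_ge0//; lra.
Qed.

Local Notation quotient x := (fun h : R => (h^-1)%:C *: (semigroup h x - x)).

Lemma generator_sub x y : A (x, y) -> quotient x h @[h --> 0^'+] --> y.
Proof.
move=> Axy; apply/rcvgP => e e0; have e4 : 0 < e / 4 by rewrite divr_gt0.
have [z [z' Az] zy] := rdenseP Adense y e4.
have z1 : 0 < rnorm z' + 1 by rewrite ltr_wpDl ?rnorm_ge0.
have d0 : 0 < e / 2 / (rnorm z' + 1) by rewrite !divr_gt0.
near=> h.
have h0 : 0 < h by near: h; exact: nbhs_right_gt.
have hd : h < e / 2 / (rnorm z' + 1) by near: h; exact: nbhs_right_lt.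
have hn : h != 0 by rewrite gt_eqF.
have -> : y - quotient x h = (- h^-1)%:C *: (semigroup h x - x - h%:C *: y).
  by vector_ring.
rewrite rnormZ normrN gtr0_norm ?invr_gt0// ltr_pdivrMl//.
apply: le_lt_trans (semigroup_linearization (ltW h0) Axy Az) _.
rewrite ltr_pM2l//; move: hd; rewrite ltr_pdivlMr// (rnormB y) => hd; lra.
Unshelve. all: by end_near. Qed.

Lemma generator_dissipative x y :
  quotient x h @[h --> 0^'+] --> y -> re_inner y x <= 0.
Proof.
move=> /rcvgP lim; rewrite leNgt; apply/negP => c0.
have x1 : 0 < rnorm x + 1 by rewrite ltr_wpDl ?rnorm_ge0.
near (0 : R)^'+ => h.
have h0 : 0 < h by near: h; exact: nbhs_right_gt.
have : rnorm (y - quotient x h) < re_inner y x / (rnorm x + 1).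
  by near: h; apply: lim; rewrite divr_gt0.
rewrite ltr_pdivlMr// => hy.
have : re_inner (y - quotient x h) x <= rnorm (y - quotient x h) * rnorm x.
  exact: le_trans (ler_norm _) (rnorm_cauchy_schwarz _ _).
have : re_inner (quotient x h) x <= 0.
  rewrite (rformZl re_inner_form) pmulr_rle0 ?invr_gt0//.
  rewrite !(rformE re_inner_form) subr_le0 re_inner_norm.
  apply: le_trans (ler_norm _) (le_trans (rnorm_cauchy_schwarz _ _) _).
  by rewrite expr2 ler_wpM2r ?rnorm_ge0// semigroup_contraction.
have -> : re_inner (y - quotient x h) x =
  re_inner y x - re_inner (quotient x h) x by rewrite !(rformE re_inner_form).
have := rnorm_ge0 (y - quotient x h); lra.
Unshelve. all: by end_near. Qed.
End Semigroup.

(** The generator of the semigroup contains [A] and is dissipative. Given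
    [(x, y)] in it, surjectivity of [1 - A] provides [(a, b)] in [A] with
    [a - b = x - y]; then [(a - x, b - y)] lies in the generator and
    [|a - x|^2 = Re <b - y, a - x> <= 0]. *)
Theorem lumer_phillips (R : realType) (X : hilbertType R) (A : set (X * X)) :
  m_dissipative A -> dense (dom A) -> generates_contraction_semigroup A.
Proof.
move=> Amd Adense; exists (semigroup_map Amd Adense); split.
  split=> [x|s t x s0 t0|x|t x t0].
  - exact: semigroup0.
  - exact: semigroupD.
  - exact/continuous_subspaceT/semigroup_continuous.
  - exact: semigroup_contraction.
have [Asub _ Arange] := Amd.
apply/seteqP; split=> [[x y]|[x y] xy]; first exact: generator_sub.
have [[a b] Aab /=] := Arange 1 (x - y) ltr01; rewrite scale1r => ab.
have abxy : a - x = b - y by vector_from ab.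
have gen : (h^-1)%:C *: (semigroup A h (a - x) - (a - x)) @[h --> 0^'+] --> b - y.
  have -> : (fun h => (h^-1)%:C *: (semigroup A h (a - x) - (a - x))) =
      (fun h => (h^-1)%:C *: (semigroup A h a - a) -
                (h^-1)%:C *: (semigroup A h x - x)).
    by apply/funext => h; rewrite (semigroupB Amd Adense); vector_ring.
  by apply: cvgB xy; exact: generator_sub.
have := generator_dissipative Amd Adense gen; rewrite -abxy => ax.
have ax0 : a - x = 0 by exact: re_inner_eq0.
by move: Aab; rewrite -(subr0_eq ax0) -(subr0_eq (etrans (esym abxy) ax0)).
Qed.

(** * Adjoints of dissipative and of closed relations *)

(** Since [|p.1| <= |p.1 - h p.2|] on [T], the relation between
    [p.1 - h p.2] and [Re <p.1, z>] is a bounded functional; its representing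
    vector [a] satisfies [<a, y - h t> = <z, y>] on [T], which says that
    [h^-1 (a - z)] is a value of the adjoint at [a]. *)
Lemma adjoint_range (R : realType) (X : hilbertType R) (T : set (X * X))
    (h : R) (z : X) : Defs.subspace T -> dissipative T -> 0 < h ->
  exists2 p, adjoint T p & p.1 - h%:C *: p.2 = z.
Proof.
move=> Tsub Tdis h0.
have [|||a aP] := @riesz_relation _ _ _ (@re_inner_form _ X)
  [set p | exists2 q, T q & p = (q.1 - h%:C *: q.2, re_inner q.1 z)]
  (rnorm z ^+ 2) (@re_inner_complete _ X).
- by exists 0; [exact: Tsub.1|rewrite /= scaler0 subr0 re_inner0].
- move=> t _ _ [p Tp ->] [q Tq ->]; exists (t%:C *: p + q); first exact: Tsub.2.
  congr (_, _) => /=; first by vector_ring.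
  by rewrite !(rformE re_inner_form).
- move=> _ [q Tq ->] /=; apply: le_trans (form_cauchy_schwarz re_inner_form _ _) _.
  rewrite !re_inner_norm mulrC ler_wpM2l ?sqr_ge0// ler_pXn2r ?nnegrE ?rnorm_ge0//.
  exact: dissipative_expansive (ltW h0) Tq.
have hn : h != 0 by rewrite gt_eqF.
exists (a, (h^-1)%:C *: (a - z)); last by rewrite /=; vector_ring.
apply: adjoint_re Tsub _ => p Tp /=.
have := aP _ (ex_intro2 _ _ p Tp erefl) => /=.
rewrite !(rformE re_inner_form) !(rformC re_inner_form a) => e.
by rewrite -e; field.
Qed.

(** The component [n] of [p] orthogonal to [S] gives [(n.2, - n.1)] in the
    adjoint of [S]; testing [p] against it shows that [p] is orthogonal
    to [n]. *)
Lemma adjointK (R : realType) (H1 H2 : hilbertType R) (S : set (H1 * H2)) p :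
  closed S -> Defs.subspace S -> adjoint (adjoint S) p -> S p.
Proof.
move=> Scl Ssub Sp.
have [m Sm orth] := closed_orthogonal_projection p Scl (subspace_real Ssub).
suff : p - m = 0 by move/subr0_eq->.
have [n nE] : exists n, n = p - m by exists (p - m).
have pE : p = n + m by rewrite nE subrK.
rewrite -nE in orth *; have Sn : adjoint S (n.2, - n.1).
  apply: adjoint_re Ssub _ => s Ss /=; have := orth s Ss.
  rewrite /prod_form (rformNr re_inner_form).
  by rewrite !(rformC re_inner_form _ s.1) !(rformC re_inner_form _ s.2); lra.
have := congr1 (fun c => complex.Re c) (Sp _ Sn); have := orth m Sm.
rewrite /= -!/(re_inner _ _) {1}pE /prod_form /= (rformNl re_inner_form).
move=> om; rewrite pE /= !(rformDr re_inner_form) => e.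
have n1 := form_ge0 re_inner_form n.1; have n2 := form_ge0 re_inner_form n.2.
have {e} : re_inner n.1 n.1 + re_inner n.2 n.2 = 0 by lra.
move=> /eqP; rewrite paddr_eq0// !re_inner_norm !sqrf_eq0.
case: n {nE pE orth Sn om n1 n2} => a b /= /andP[/eqP a0 /eqP b0].
by rewrite (rnorm0_eq0 a0) (rnorm0_eq0 b0).
Qed.

Lemma closure_subspace (R : realType) (V : normedModType R[i]) (S : set V) :
  Defs.subspace S -> Defs.subspace (closure S).
Proof.
move=> Ssub; split; first exact/subset_closure/Ssub.1.
move=> a x y /rclosureP Sx /rclosureP Sy; apply/rclosureP => e e0.
have a1 : 0 < complex.Re `|a| + 1.
  by rewrite ltr_wpDl// -ler0c RRe_real// ger0_real.
have e2 : 0 < e / 2 by rewrite divr_gt0.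
have [s Ss sx] := Sx _ (divr_gt0 e2 a1); have [s' Ss' sy] := Sy _ e2.
exists (a *: s + s'); first exact: Ssub.2.
have -> : a *: s + s' - (a *: x + y) = a *: (s - x) + (s' - y).
  by rewrite scalerBr opprD addrACA.
apply: le_lt_trans (rnormD _ _) _; rewrite [ltRHS]splitr ler_ltD//.
rewrite rnormZc; move: sx; rewrite ltr_pdivlMr// => sx; have := rnorm_ge0 (s - x); lra.
Qed.

Lemma bounded_adjoint_linear (R : realType) (H1 H2 : hilbertType R)
    (f : {linear H1 -> H2}) (a : R[i]) x y : bounded_operator f ->
  bounded_adjoint f (a *: x + y) = a *: bounded_adjoint f x + bounded_adjoint f y.
Proof.
move=> fb; apply: re_inner_ext => w; rewrite /re_inner innerC.
rewrite [in RHS]innerC -(bounded_adjointP fb) !linearDr !linearZr_LR /=.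
by rewrite !(bounded_adjointP fb).
Qed.

(** Apply the real inequality to [conj c *: x] with [c = <x, y>], whose real
    inner product with [y] is [|c|^2]. *)
Lemma norm_inner_le (R : realType) (H : hilbertType R) (x y : H) :
  complex.Re `|'[x, y]| <= rnorm x * rnorm y.
Proof.
have [c cE] : exists c, '[x, y] = c by exists '[x, y].
rewrite cE; have rc : (complex.Re `|c|)%:C = `|c|.
  by rewrite RRe_real// ger0_real.
have le : complex.Re `|c| ^+ 2 <= complex.Re `|c| * rnorm x * rnorm y.
  have := le_trans (ler_norm _) (rnorm_cauchy_schwarz (Num.conj c *: x) y).
  rewrite /re_inner linearZl_LR [X in complex.Re X]/= cE rnormZc norm_conjC.
  by rewrite mulrC -normCK -{1}rc -rmorphXn.
have c0 : 0 <= complex.Re `|c| by rewrite -ler0c rc.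
have [->|cn0] := eqVneq (complex.Re `|c|) 0; first by rewrite mulr_ge0 ?rnorm_ge0.
by rewrite -(@ler_pM2l _ (complex.Re `|c|)) ?lt_def ?cn0// mulrA -expr2.
Qed.

(** * Quasi Gelfand triples and the row operator *)

Lemma linear_on0 (K : numFieldType) (U V : lmodType K) (D : set U) (f : U -> V) :
  Defs.subspace D -> linear_on D f -> f 0 = 0.
Proof.
move=> [D0 _] /(_ 1 0 0 D0 D0); rewrite !scale1r addr0 => /eqP.
by rewrite -subr_eq subrr eq_sym => /eqP.
Qed.

Section QuasiGelfand.
Context {R : realType} {Bp B0 : hilbertType R} {Bm : completeNormedModType R[i]}.
Variable G : quasi_gelfand_triple Bp B0 Bm.
Variable Psi : {linear Bm -> Bp}.
Hypothesis hPsi : duality_map G Psi.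

Lemma iota_p_subspace : Defs.subspace (iota_p G).
Proof.
apply: closure_subspace.
have [D0 Dlin] := qg_subspace G; have [elin _ _] := qg_completion_p G.
split.
  by exists 0 => //; rewrite (linear_on0 (qg_subspace G) elin).
move=> a _ _ [f Df <-] [g Dg <-]; exists (a *: f + g); first exact: Dlin.
by rewrite elin.
Qed.

(** The domain of [iota_p] contains the dense image of [qg_dom] in [B+]. *)
Lemma adjoint_iota_inj g a a' :
  adjoint (iota_p G) (g, a) -> adjoint (iota_p G) (g, a') -> a = a'.
Proof.
move=> ga ga'; apply/subr0_eq/re_inner_eq0.
suff -> : re_inner (a - a') (a - a') = 0 by [].
have [_ _ edense] := qg_completion_p G.
apply: (@adherent_orthogonal _ _ _ re_inner_form (qg_emb_p G @` qg_dom G)).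
  move=> e e0; have se : 0 < Num.sqrt e by rewrite sqrtr_gt0.
  have [s Ss sa] := rdenseP edense (a - a') se; exists s => //.
  by rewrite -(sqr_sqrtr (ltW e0)) re_inner_lt.
move=> _ [f Df <-].
have If : iota_p G (qg_emb_p G f, f) by apply: subset_closure; exists f.
rewrite (rformC re_inner_form) (rformDr re_inner_form) (rformNr re_inner_form).
by rewrite /re_inner -(ga _ If) -(ga' _ If) subrr.
Qed.

(** If [iota_+^* g = a], the dual norm of [g] is at most [|a|]. *)
Lemma adjoint_iota_Dminus g a : adjoint (iota_p G) (g, a) -> Dminus G g.
Proof.
move=> ga; apply: (@le_lt_trans _ _ (rnorm a)%:E); last exact: ltry.
apply: ge_ereal_sup => _ [f [Df fn0] <-].
have [_ enorm _] := qg_completion_p G; have [_ _ ipos] := qg_inner G.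
have If : iota_p G (qg_emb_p G f, f) by apply: subset_closure; exists f.
have Nf : 0 < ip_norm (qg_ip G) f.
  rewrite sqrtr_gt0; have := ipos f Df; rewrite ltcE => /(_ _)/andP[]//.
  by apply/eqP => f0; apply: fn0.
rewrite lee_fin ler_pdivrMr// innerC norm_conjC (ga _ If) mulrC -enorm//.
exact: norm_inner_le.
Qed.

(** The domain of [iota_+^*] is [D-], and there [iota_+^*] is [Psi] composed
    with the embedding into [B-]. *)
Lemma iota_mE w g : iota_m G (w, g) <-> adjoint (iota_p G) (g, Psi w).
Proof.
have [[Phi PhiK _] _ Padj] := hPsi.
split=> [[h Dh [<- <-]]|ga]; first exact: Padj.
have Dg := adjoint_iota_Dminus ga.
exists g => //; congr (_, _); apply: (can_inj PhiK).
exact: adjoint_iota_inj (Padj _ Dg) ga.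
Qed.

Section Row.
Variables (K : hilbertType R) (V1 V2 : {linear B0 -> K}).
Hypotheses (V1b : bounded_operator V1) (V2b : bounded_operator V2).
Hypothesis Wcl : closed (row_operator G V1 V2).

(** The range of the adjoint of the row operator, with [B-] replaced by [B+]
    through the duality map. *)
Definition row_adjoint_range : set (Bp * Bp) :=
  [set p | exists k, adjoint (iota_p G) (bounded_adjoint V1 k, p.1) /\
                     iota_p G (p.2, bounded_adjoint V2 k)].

Lemma row_adjoint_range_subspace : Defs.subspace row_adjoint_range.
Proof.
have [I0 Il] := iota_p_subspace; have [J0 Jl] := adjoint_subspace (iota_p G).
have V0 (f : {linear B0 -> K}) : bounded_operator f -> bounded_adjoint f 0 = 0.
  move=> fb; have := bounded_adjoint_linear (-1) 0 0 fb.
  by rewrite scaler0 addr0 scaleN1r addNr.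
split; first by exists 0; rewrite !V0.
move=> a p q [k [k1 k2]] [k' [k1' k2']]; exists (a *: k + k').
rewrite !bounded_adjoint_linear//; split.
  exact: (Jl a (_, _) (_, _) k1 k1').
exact: (Il a (_, _) (_, _) k2 k2').
Qed.

(** For [p] given by [k], the number [<p.2, p.1>] is [<V2^* k, V1^* k>], and
    the quadratic form of [V1 V2^* + V2 V1^*] at [k] is twice its real
    part. *)
Lemma row_adjoint_range_nonneg p :
  nonneg_operator (fun k : K =>
    V1 (bounded_adjoint V2 k) + V2 (bounded_adjoint V1 k)) ->
  row_adjoint_range p -> 0 <= re_inner p.1 p.2.
Proof.
move=> Vpos [k [ka kb]]; have := Vpos k; rewrite lecE => /andP[_].
rewrite linearDl /= ReD (@bounded_adjointP _ _ _ V1 V1b) (@bounded_adjointP _ _ _ V2 V2b) -!/(re_inner _ _).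
rewrite (rformC re_inner_form (bounded_adjoint V1 k)).
have -> : re_inner (bounded_adjoint V2 k) (bounded_adjoint V1 k) =
    re_inner p.1 p.2 by rewrite (rformC re_inner_form p.1) /re_inner -(ka _ kb).
lra.
Qed.

(** Project [((u, v), 0)] onto the graph [W] of the row operator, transported
    to [(B+ x B+) x K]. The remainder is [((alpha, beta), - k)] with
    [(alpha, beta)] the value at [k] of the adjoint of the row operator, where
    the closedness of [iota_p] identifies [beta]. By hypothesis it is
    orthogonal to [((u, v), 0)], hence to itself, so it vanishes. *)
Lemma row_kernel_biorthogonal u v :
  (forall p, row_adjoint_range p -> re_inner u p.1 + re_inner v p.2 = 0) ->
  exists f g, [/\ iota_p G (u, f), adjoint (iota_p G) (g, v) & V1 f + V2 g = 0].
Proof.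
move=> uvN; have Isub := iota_p_subspace.
have [[I0 Il] [J0 Jl]] := (Isub, adjoint_subspace (iota_p G)).
pose W : set ((Bp * Bp) * K) := [set p | exists f g,
  [/\ iota_p G (p.1.1, f), adjoint (iota_p G) (g, p.1.2) & p.2 = V1 f + V2 g]].
have Wsub : real_subspace W.
  split; first by exists 0, 0; split=> //=; rewrite !linear0 addr0.
  move=> t p q [f [g [p1 p2 pk]]] [f' [g' [q1 q2 qk]]].
  exists (t%:C *: f + f'), (t%:C *: g + g'); split.
  - exact: (Il _ (_, _) (_, _) p1 q1).
  - exact: (Jl _ (_, _) (_, _) p2 q2).
  - by rewrite /= pk qk !linearP /= scalerDr addrACA.
pose b := prod_form (prod_form (@re_inner _ Bp) (@re_inner _ Bp)) (@re_inner _ K).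
have bform : real_form b.
  by do 2?apply: prod_form_form; exact: re_inner_form.
have bcplt : form_complete b.
  by do 2?apply: prod_form_complete; try apply: prod_form_form;
     first [exact: re_inner_form | exact: re_inner_complete].
have [m Wm orth] := orthogonal_projection bform ((u, v), 0) bcplt Wsub.
have {}Wm : W m.
  have [[Phi PhiK KPhi] Pnorm _] := hPsi.
  have : row_operator G V1 V2 ((m.1.1, Phi m.1.2), m.2).
    apply: Wcl; apply/rclosureP => e e0.
    have [s [f [g [s1 s2 sk]]]] := Wm _ (exprn_gt0 2 e0).
    rewrite /b /prod_form /= => lt.
    exists ((s.1.1, Phi s.1.2), s.2).
      by exists f, g; split=> //=; apply/iota_mE; rewrite KPhi.
    rewrite !rnorm_pair /=.
    have -> : rnorm (Phi s.1.2 - Phi m.1.2) = rnorm (s.1.2 - m.1.2).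
      by rewrite /rnorm -Pnorm linearB !KPhi.
    have n1 := form_ge0 re_inner_form (s.1.1 - m.1.1).
    have n2 := form_ge0 re_inner_form (s.1.2 - m.1.2).
    have n3 := form_ge0 re_inner_form (s.2 - m.2).
    by rewrite -!re_inner_lt//; apply/andP; split; [apply/andP; split|]; lra.
  move=> [f [g [/= m1 /iota_mE m2 mk]]]; exists f, g; split=> //.
  by rewrite KPhi in m2.
case: m => -[mu mv] k in Wm orth *.
have Nuv : row_adjoint_range (u - mu, v - mv).
  exists k; split=> /=.
    apply: adjoint_re Isub _ => -[x f] If /=.
    have Wx : W ((x, 0), V1 f) by exists f, 0; rewrite linear0 addr0.
    have := orth _ Wx; rewrite /b /prod_form /=.
    rewrite /re_inner -(@bounded_adjointP _ _ _ V1 V1b) -!/(re_inner _ _).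
    rewrite (rformC re_inner_form _ 0) re_inner0 sub0r (rformNl re_inner_form).
    by rewrite (rformC re_inner_form x) (rformC re_inner_form (V1 f)); lra.
  apply: adjointK (@closed_closure _ _) Isub _.
  apply: adjoint_re (adjoint_subspace _) _ => -[g x] Jg /=.
  have Wx : W ((0, x), V2 g) by exists 0, g; rewrite linear0 add0r.
  have := orth _ Wx; rewrite /b /prod_form /=.
  rewrite /re_inner -(@bounded_adjointP _ _ _ V2 V2b) -!/(re_inner _ _).
  rewrite (rformC re_inner_form _ 0) re_inner0 sub0r (rformNl re_inner_form).
  by rewrite (rformC re_inner_form x) (rformC re_inner_form (V2 g)); lra.
have mE : ((u, v), 0) = ((mu, mv), k).
  have := orth _ Wm; have := uvN _ Nuv; rewrite /b /prod_form /= sub0r.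
  rewrite (rformNl re_inner_form) (rformC re_inner_form u).
  rewrite (rformC re_inner_form v) => e1 e2.
  have := form_ge0 re_inner_form (u - mu).
  have := form_ge0 re_inner_form (v - mv).
  have := form_ge0 re_inner_form k => n3 n2 n1.
  have sum0 : re_inner (u - mu) (u - mu) + re_inner (v - mv) (v - mv) +
      re_inner k k = 0.
    rewrite (rformDr re_inner_form (u - mu)) (rformNr re_inner_form (u - mu)).
    rewrite (rformDr re_inner_form (v - mv)) (rformNr re_inner_form (v - mv)).
    lra.
  have /subr0_eq-> : u - mu = 0 by apply: re_inner_eq0; lra.
  have /subr0_eq-> : v - mv = 0 by apply: re_inner_eq0; lra.
  by have -> : k = 0 by apply: re_inner_eq0; lra.
by move: Wm; rewrite -mE => -[f [g [/= uf gv e]]]; exists f, g.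
Qed.
End Row.
End QuasiGelfand.

(** * The semigroup generated under the boundary condition *)

Lemma dense_subset (R : realType) (V : normedModType R[i]) (S S' : set V) :
  S `<=` S' -> dense S -> dense S'.
Proof. by move=> SS' Sd O O0 /(Sd O O0)[x [Ox /SS' Sx]]; exists x. Qed.

Lemma dom_subspace (K : numFieldType) (U V : lmodType K) (S : set (U * V)) :
  Defs.subspace S -> Defs.subspace (dom S).
Proof.
move=> [S0 Sl]; split; first by exists 0.
by move=> a x y [x' Sx] [y' Sy]; exists (a *: x' + y'); exact: (Sl _ _ _ Sx Sy).
Qed.

(** By skew-symmetry the left-hand side of Green's identity vanishes at [p] and
    any [y]; choose [y] with boundary values [C1 y = C2 p] and
    [C2 y = C1 p]. *)
Lemma boundary_triple_vanish (R : realType) (X B : hilbertType R)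
    (A0 : set (X * X)) (C1 C2 : X -> B) p :
  boundary_triple A0 C1 C2 -> skew_symmetric A0 -> A0 p ->
  C1 p.1 = 0 /\ C2 p.1 = 0.
Proof.
move=> [_ _ surj green] skew Ap.
have [y [y' Ay] [C1y C2y]] := surj (C2 p.1) (C1 p.1).
have := green (p.1, - p.2) (y, y') (skew p Ap) Ay.
rewrite /= linearNl /= (Ay p Ap : inner p.2 y = inner p.1 y') addNr C1y C2y => /(congr1 (fun c => complex.Re c)).
rewrite ReD -!/(re_inner _ _) !re_inner_norm => /esym/eqP.
rewrite paddr_eq0 ?sqr_ge0// !sqrf_eq0 => /andP[/eqP c1 /eqP c2].
by rewrite (rnorm0_eq0 c1) (rnorm0_eq0 c2).
Qed.

Theorem theorem6p7 (R : realType)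
    (Bp B0 : hilbertType R) (Bm : completeNormedModType R[i])
    (G : quasi_gelfand_triple Bp B0 Bm)
    (Psi : {linear Bm -> Bp}) (hPsi : duality_map G Psi)
    (X : hilbertType R) (A0 : set (X * X))
    (A0_op : linear_operator A0) (A0_dense : dense (dom A0))
    (A0_closed : closed A0) (A0_skew : skew_symmetric A0)
    (B1 : X -> Bp) (B2 : X -> Bm)
    (B1_lin : linear_on (dom (adjoint A0)) B1)
    (B2_lin : linear_on (dom (adjoint A0)) B2)
    (hB : boundary_triple A0 B1 (Psi \o B2))
    (K : hilbertType R) (V1 V2 : {linear B0 -> K})
    (V1_bounded : bounded_operator V1) (V2_bounded : bounded_operator V2)
    (row_closed : closed (row_operator G V1 V2))
    (ker_dissipative : dissipative (row_kernel V1 V2))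
    (V_nonneg : nonneg_operator (fun k : K =>
       V1 (bounded_adjoint V2 k) + V2 (bounded_adjoint V1 k))) :
  generates_contraction_semigroup
    (restriction (adjoint A0) (boundary_domain G A0 B1 B2 V1 V2)).
Proof.
set A := restriction _ _.
have [_ _ surj green] := hB.
have Ssub := adjoint_subspace A0; have Dsub := dom_subspace Ssub.
have B10 := linear_on0 Dsub B1_lin; have B20 := linear_on0 Dsub B2_lin.
have Isub := iota_p_subspace G; have Jsub := adjoint_subspace (iota_p G).
have A_intro a a' f g : adjoint A0 (a, a') -> iota_p G (B1 a, f) ->
    adjoint (iota_p G) (g, Psi (B2 a)) -> V1 f + V2 g = 0 -> A (a, a').
  move=> Aa If Jg Vfg; split=> //; split; first by exists a'.
  by exists f, g; split=> //; exact/(iota_mE hPsi).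
have A_elim a a' : A (a, a') -> adjoint A0 (a, a') /\ exists f g,
    [/\ iota_p G (B1 a, f), adjoint (iota_p G) (g, Psi (B2 a)) & V1 f + V2 g = 0].
  by move=> [Aa [_ [f [g [If /(iota_mE hPsi) Jg Vfg]]]]]; split=> //; exists f, g.
have A0_vanish p : A0 p -> B1 p.1 = 0 /\ Psi (B2 p.1) = 0.
  exact: boundary_triple_vanish hB A0_skew.
have A0_sub p : A0 p -> A (p.1, - p.2).
  move=> Ap; have [b1 b2] := A0_vanish p Ap.
  apply: (A_intro _ _ 0 0); first exact: A0_skew.
  - by rewrite b1; exact: Isub.1.
  - by rewrite b2; exact: Jsub.1.
  - by rewrite !linear0 addr0.
pose N := row_adjoint_range G V1 V2.
have Nsub : Defs.subspace N by exact: row_adjoint_range_subspace.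
(* the restriction of [- A0^*] to the vectors with boundary values in [N] *)
pose T : set (X * X) :=
  [set p | adjoint A0 (p.1, - p.2) /\ N (Psi (B2 p.1), B1 p.1)].
have Tsub : Defs.subspace T.
  split.
    split; first by rewrite /= oppr0; exact: Ssub.1.
    by rewrite /= B10 B20 linear0; exact: Nsub.1.
  move=> a p q [Ap Np] [Aq Nq]; split.
    have := Ssub.2 a _ _ Ap Aq; congr (adjoint _ (_, _)) => /=.
    by rewrite scalerN opprD.
  have Dp : dom (adjoint A0) p.1 by exists (- p.2).
  have Dq : dom (adjoint A0) q.1 by exists (- q.2).
  have := Nsub.2 a _ _ Np Nq; congr (N (_, _)) => /=.
    by rewrite B2_lin// linearP.
  by rewrite B1_lin.
have Tdis : dissipative T.
  move=> p [Ap Np]; have := green _ _ Ap Ap => /(congr1 (fun c => complex.Re c)).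
  have := row_adjoint_range_nonneg V1_bounded V2_bounded V_nonneg Np.
  rewrite /= !ReD -!/(re_inner _ _) (rformNl re_inner_form) (rformNr re_inner_form).
  by rewrite (rformC re_inner_form p.2) (rformC re_inner_form (B1 _)); lra.
have Tadj : adjoint T `<=` A.
  move=> [a b] Tab.
  have Aab : adjoint A0 (a, b).
    move=> p Ap; apply: Tab; split; first exact: A0_skew.
    by have [-> ->] := A0_vanish p Ap; exact: Nsub.1.
  have [|f [g [If Jg Vfg]]] := @row_kernel_biorthogonal _ _ _ _ _ _ hPsi _ _ _
      V1_bounded V2_bounded row_closed (B1 a) (Psi (B2 a)).
    move=> [al be] Nab /=; have [y [y' Ay] [/= B1y B2y]] := surj be al.
    have Ty : T (y, - y') by split; rewrite /= ?opprK// B1y B2y.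
    have := green _ _ Ay Aab; rewrite /= B1y B2y.
    have := Tab _ Ty; rewrite /= => <-; rewrite linearNl addrN.
    move=> /(congr1 (fun c => complex.Re c)); rewrite ReD -!/(re_inner _ _) /=.
    by rewrite (rformC re_inner_form al) (rformC re_inner_form be) addrC => <-.
  exact: A_intro Aab If Jg Vfg.
apply: lumer_phillips; last first.
  apply: dense_subset A0_dense => x [y Axy].
  by exists (- y); exact: (A0_sub (x, y) Axy).
split.
- split.
    apply: (A_intro _ _ 0 0); first exact: Ssub.1.
    + by rewrite B10; exact: Isub.1.
    + by rewrite B20 linear0; exact: Jsub.1.
    + by rewrite !linear0 addr0.
  move=> c [a a'] [b b'] /A_elim[Aa [f [g [If Jg Vfg]]]].
  move=> /A_elim[Ab [f' [g' [If' Jg' Vfg']]]].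
  have Da : dom (adjoint A0) a by exists a'.
  have Db : dom (adjoint A0) b by exists b'.
  apply: (A_intro _ _ (c *: f + f') (c *: g + g')).
  + exact: (Ssub.2 _ _ _ Aa Ab).
  + by rewrite B1_lin//; exact: (Isub.2 _ _ _ If If').
  + by rewrite B2_lin// linearP; exact: (Jsub.2 _ _ _ Jg Jg').
  + by rewrite !linearP /= addrACA -scalerDr Vfg Vfg' scaler0 addr0.
- move=> [a a'] /A_elim[Aa [f [g [If Jg Vfg]]]].
  have := green _ _ Aa Aa => /(congr1 (fun c => complex.Re c)).
  have := ker_dissipative (f, g) Vfg.
  rewrite /= !ReD (Jg _ If) -!/(re_inner _ _).
  by rewrite (rformC re_inner_form a') (rformC re_inner_form (Psi _)); lra.
- move=> h z h0; have [p Tp e] := adjoint_range z Tsub Tdis h0.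
  by exists p => //; exact: Tadj.
Qed.
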